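(* Let $\bm{\mu}=(\mu_1,\ldots,\mu_r)=\mathcal{N}(\sigma_1,\ldots,\sigma_r)$ be a Nikishin system on the real line, with associated intervals $\Delta_1,\ldots,\Delta_r$. Suppose $\bm{n}=(n_1,\ldots,n_r)\in\mathbb{N}^r$ satisfies $$n_j\ge \max\{n_{j+1},\ldots,n_r\}-1\qquad\text{for any } j=1,\ldots,r-1.$$ Then $\bm{\mu}$ is AT on $\Delta_1$ at $\bm{n}$.
   Context: $r\ge1$; $\mathbb{N}=\{0,1,2,\ldots\}$; $|\bm{n}|=n_1+\cdots+n_r$. For $\Delta\subseteq\mathbb{R}$, $\mathcal{M}(\Delta)$ is the set of all finite Borel measures of constant sign (either positive or negative), with all moments finite and with infinite support contained in $\Delta$. $\mathring{S}$ is the interior of $S$ in $\mathbb{R}$. The $m$-function of a measure $\mu$ is $m_\mu(x)=\int_{\mathbb{R}}\frac{d\mu(t)}{t-x}$. Brackets. Given two intervals $\Delta_1,\Delta_2$ with $\mathring{\Delta}_1\cap\mathring{\Delta}_2=\varnothing$ and two measures $\sigma_1\in\mathcal{M}(\Delta_1)$, $\sigma_2\in\mathcal{M}(\Delta_2)$, $\langle\sigma_1,\sigma_2\rangle$ denotes the measure in $\mathcal{M}(\Delta_1)$ given by $d\langle\sigma_1,\sigma_2\rangle(x)=m_{\sigma_2}(x)\,d\sigma_1(x)$. If $\Delta_1$ and $\Delta_2$ share a common endpoint, then writing $\langle\sigma_1,\sigma_2\rangle$ includes the implicit assumption that this formula defines a finite measure. Iterated brackets are nested to the right: $\langle\sigma_j\rangle=\sigma_j$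 and $\langle\sigma_j,\sigma_{j+1},\ldots,\sigma_d\rangle=\langle\sigma_j,\langle\sigma_{j+1},\ldots,\sigma_d\rangle\rangle$. Nikishin system. $\bm{\mu}=(\mu_1,\ldots,\mu_r)\in\mathcal{M}(\mathbb{R})^r$ forms a Nikishin system generated by $(\sigma_1,\ldots,\sigma_r)$, written $\bm{\mu}=\mathcal{N}(\sigma_1,\ldots,\sigma_r)$, if there is a collection of intervals $\Delta_1,\ldots,\Delta_r$ with $\mathring{\Delta}_j\cap\mathring{\Delta}_{j+1}=\varnothing$ for $j=1,\ldots,r-1$ and measures $\sigma_j\in\mathcal{M}(\Delta_j)$, $j=1,\ldots,r$, so that $\mu_1=\sigma_1$, $\mu_2=\langle\sigma_1,\sigma_2\rangle$, $\mu_3=\langle\sigma_1,\langle\sigma_2,\sigma_3\rangle\rangle$, ..., $\mu_r=\langle\sigma_1,\langle\sigma_2,\ldots,\sigma_r\rangle\rangle$. Each $\mu_j$ is then absolutely continuous with respect to $\sigma_1$, with Radon–Nikodym derivative $1$ for $j=1$ and $m_{\langle\sigma_2,\ldots,\sigma_j\rangle}$ for $j\ge2$; these are the weights in the AT property below, with $\sigma_1$ as the reference measure. Chebyshev system. A collection of continuous functions $f_1,\ldots,f_n$ on an interval $\Delta$ is a Chebyshev system on $\Delta$ if $\det(f_i(x_j))_{i,j=1}^n\ne0$ for every choice of distinct points $x_1,\ldots,x_n\in\Delta$. AT system. Let $\mu\in\mathcal{M}(\Delta)$ and, for each $j=1,\ldots,r$, let $\mu_j\in\mathcal{M}(\Delta)$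 be absolutely continuous with respect to $\mu$, $d\mu_j(x)=w_j(x)\,d\mu(x)$. The system $(\mu_1,\ldots,\mu_r)$ is an AT system on $\Delta$ at $\bm{n}\in\mathbb{N}^r$ if the $|\bm{n}|$ functions $x^p w_j(x)$, $0\le p\le n_j-1$, $1\le j\le r$, form a Chebyshev system on $\Delta$.
   Formalization: The Chebyshev property is asserted at all points of Δ_1 where the weights w_j with n_j>0 are finite; this is all of Δ_1 except possibly an endpoint shared with Δ_2, where some w_j may diverge (e.g. Lebesgue measure on [0,1] and [-1,0]) and the claim has no meaning. *)

(* Defs.v *)
From HB Require Import structures.
From mathcomp Require Import all_boot all_order all_algebra.
From mathcomp Require Import all_classical all_reals all_analysis.

Set Implicit Arguments.
Unset Strict Implicit.
Unset Printing Implicit Defensive.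

Import Order.TTheory GRing.Theory Num.Theory.
Import numFieldNormedType.Exports.

Local Open Scope classical_set_scope.
Local Open Scope ring_scope.
Local Open Scope ereal_scope.

Notation borel_charge R := ({charge set (measurableTypeR R) -> \bar R})%type.

Section signed_integration.
Context {R : realType}.
Implicit Types (nu : borel_charge R) (f : R -> \bar R) (A : set R).

Lemma hahn_pair nu : {PN | hahn_decomposition nu PN.1 PN.2}.
Proof.
by apply: cid; have [P [N h]] := Hahn_decomposition nu; exists (P, N).
Qed.

(* The Jordan parts do not depend on the chosen Hahn decomposition
   (Hahn_decomposition_uniq). *)
Definition pos_part nu := jordan_pos (svalP (hahn_pair nu)).
Definition neg_part nu := jordan_neg (svalP (hahn_pair nu)).

Definition cintegrable nu f : Prop :=
  (pos_part nu).-integrable setT f /\ (neg_part nu).-integrable setT f.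

Definition cintegral nu A f : \bar R :=
  \int[pos_part nu]_(t in A) f t - \int[neg_part nu]_(t in A) f t.

(* f dnu, as a signed measure; the zero charge when f is not integrable. *)
Definition cdensity f nu : borel_charge R :=
  match pselect (cintegrable nu f) with
  | left fint => cadd (induced_charge fint.1) (copp (induced_charge fint.2))
  | right _ => czero
  end.

Lemma cdensityE f nu A : cintegrable nu f ->
  cdensity f nu A = cintegral nu A f.
Proof. by rewrite /cdensity; case: pselect. Qed.

Definition csupport nu : set R :=
  [set x | forall U : set R, open U -> U x ->
     pos_part nu U + neg_part nu U != 0].

Definition constant_sign nu : Prop :=
  (forall A, measurable A -> 0 <= nu A) \/
  (forall A, measurable A -> nu A <= 0).

Definition in_M (Delta : set R) nu : Prop :=
  [/\ constant_sign nu,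
      forall k : nat, cintegrable nu (fun t => (t ^+ k)%:E),
      infinite_set (csupport nu) &
      csupport nu `<=` Delta].

(* The inverse is the one of \bar R, for which 0^-1 = +oo: a point mass at x
   makes m_nu(x) infinite, as does a divergent integral (recall that
   +oo - +oo = -oo in \bar R).  Hence m_nu(x) is a finite number exactly when
   the integral converges absolutely. *)
Definition m_function nu (x : R) : \bar R :=
  cintegral nu setT (fun t => ((t - x)%:E)^-1).

(* d<s1, s2> = m_s2 ds1 *)
Definition bracket (s1 s2 : borel_charge R) : borel_charge R :=
  cdensity (m_function s2) s1.

Definition bracket_defined (s1 s2 : borel_charge R) : Prop :=
  cintegrable s1 (m_function s2).

(* <s_1, <s_2, ..., s_d>>; the value on the empty sequence is irrelevant. *)
Fixpoint brackets (s : seq (borel_charge R)) : borel_charge R :=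
  match s with
  | [::] => czero
  | [:: s1] => s1
  | s1 :: s' => bracket s1 (brackets s')
  end.

Fixpoint brackets_defined (s : seq (borel_charge R)) : Prop :=
  match s with
  | s1 :: ((_ :: _) as s') =>
      bracket_defined s1 (brackets s') /\ brackets_defined s'
  | _ => True
  end.

End signed_integration.

(* sigma_i, ..., sigma_j, with indices starting at 0 *)
Definition segment {T : Type} {r : nat} (sigma : 'I_r -> T) (i j : nat) :
    seq T :=
  [seq sigma k | k : 'I_r <- enum 'I_r & (i <= k <= j)%N].

Section systems.
Context {R : realType}.

Record nikishin_system (r : nat) (Delta : 'I_r -> set R)
    (sigma mu : 'I_r -> borel_charge R) : Prop := {
  nikishin_itv : forall j, is_interval (Delta j);
  nikishin_disjoint : forall i j : 'I_r, j = i.+1 :> nat ->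
    (Delta i)° `&` (Delta j)° = set0;
  nikishin_generator : forall j, in_M (Delta j) (sigma j);
  nikishin_finite : forall j : 'I_r, brackets_defined (segment sigma 0 j);
  nikishin_in_M : forall j, in_M setT (mu j);
  nikishinE : forall (j : 'I_r) (A : set R), measurable A ->
    mu j A = brackets (segment sigma 0 j) A }.

Definition nikishin_weight (r : nat) (sigma : 'I_r -> borel_charge R)
    (j : 'I_r) : R -> \bar R :=
  if j == 0%N :> nat then cst 1
  else m_function (brackets (segment sigma 1 j)).

Definition chebyshev_system (N : nat) (f : 'I_N -> R -> R) (D : set R) : Prop :=
  (forall i, {within D, continuous (f i)}) /\
  (forall x : 'I_N -> R, injective x -> (forall j, D (x j)) ->
     (\det (\matrix_(i, j) f i (x j)) != 0)%R).

(* The functions x^p w_j(x), 0 <= p < n_j; the position i in the concatenated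
   list corresponds to the pair (j, p) = (sig1 i, sig2 i). *)
Definition AT_functions (r : nat) (w : 'I_r -> R -> \bar R) (n : 'I_r -> nat)
    (i : 'I_(\sum_j n j)) (x : R) : R :=
  (x ^+ (tagnat.sig2 i) * fine (w (tagnat.sig1 i) x))%R.

(* The points of Delta at which every weight occurring in the system has a
   value.  For the weights of a Nikishin system this is all of Delta, except
   possibly for an endpoint common to the first two intervals, at which the
   integrals defining the weights may diverge. *)
Definition AT_domain (r : nat) (Delta : set R) (w : 'I_r -> R -> \bar R)
    (n : 'I_r -> nat) : set R :=
  Delta `&` [set x | forall j, (0 < n j)%N -> w j x \is a fin_num].

Definition AT_system (r : nat) (Delta : set R) (mu0 : borel_charge R)
    (w : 'I_r -> R -> \bar R) (mu : 'I_r -> borel_charge R)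
    (n : 'I_r -> nat) : Prop :=
  [/\ in_M Delta mu0,
      forall j, in_M Delta (mu j),
      forall j, cintegrable mu0 (w j) /\
        (forall A : set R, measurable A -> mu j A = cintegral mu0 A (w j)) &
      chebyshev_system (AT_functions w (n := n)) (AT_domain Delta w n)].

End systems.

(* Main.v *)
Require Import Defs.
From mathcomp Require Import all_boot all_order all_algebra.
From mathcomp Require Import all_classical all_reals all_analysis.
From mathcomp Require Import measurable_realfun zify ring lra.

Set Implicit Arguments.
Unset Strict Implicit.
Unset Printing Implicit Defensive.

Import Order.TTheory GRing.Theory Num.Theory.
Import numFieldNormedType.Exports.

(* Zeros of linear forms are counted by induction on the number of generators.
   Suppose that L = p_1 + p_2 m_<s_2> + ... + p_r m_<s_2,...,s_r>, with
   deg p_j < n_j, vanishes at N = n_1 + ... + n_r points x_i of Delta_1, and let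
   Q be the monic polynomial with simple roots x_i.  For deg h < N - n_1, the
   Lagrange identity sum_i g(x_i) / (Q'(x_i) (t - x_i)) = g(t) / Q(t), valid for
   deg g < N, applies to g = h p_j (here n_j <= n_1 + 1 is used for j > 1), while
   the divided difference sum_i (h p_1)(x_i) / Q'(x_i) vanishes.  Summing
   h(x_i) L(x_i) / Q'(x_i) = 0 over i thus gives
     int (h / Q) F ds_2 = 0, where F = p_2 + p_3 m_<s_3> + ... + p_r m_<s_3,...,s_r>.
   By induction F has fewer than N - n_1 zeros on Delta_2, so h can be chosen
   such that h F has constant sign there; so does Q, since Delta_1 and Delta_2 do
   not overlap.  Then h F vanishes s_2-almost everywhere, which contradicts the
   infinite support of s_2.

   At an endpoint shared by Delta_1 and Delta_2, finiteness of the weight makes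
   the Cauchy kernel integrable, which gives both continuity, by dominated
   convergence, and the absence of an atom of the measures involved. *)

(** * Interpolation and sign changes *)

Section lagrange_interpolation.
Local Open Scope ring_scope.
Context {K : fieldType}.
Implicit Types (s : seq K) (g : {poly K}).

Lemma horner_prod_XsubC s (P : pred K) x :
  (\prod_(y <- s | P y) ('X - y%:P)).[x] = \prod_(y <- s | P y) (x - y).
Proof. by rewrite horner_prod; apply: eq_bigr => y _; rewrite hornerXsubC. Qed.

(** The difference of the two sides has size at most [size s] and vanishes at every point of [s]. *)
Lemma lagrange_interpolation s g : uniq s -> (size g <= size s)%N ->
  g = \sum_(x <- s) (g.[x] / \prod_(y <- s | y != x) (x - y)) *:
        \prod_(y <- s | y != x) ('X - y%:P).
Proof.
move=> us gs; apply/eqP; rewrite -subr_eq0; apply/eqP.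
apply: (@roots_geq_poly_eq0 _ _ s) => //.
  apply/allP => a sa; rewrite rootE hornerD hornerN horner_sum.
  rewrite (bigD1_seq a) //= [X in - (_ + X)]big1 => [|y ya].
    rewrite addr0 hornerZ horner_prod_XsubC.
    rewrite divfK ?subrr//; rewrite prodf_seq_neq0.
    by apply/allP => y _; apply/implyP; rewrite subr_eq0 eq_sym.
  rewrite hornerZ horner_prod_XsubC.
  have -> : \prod_(z <- s | z != y) (a - z) = 0.
    apply/eqP; rewrite prodf_seq_eq0; apply/hasP; exists a => //.
    by rewrite eq_sym ya subrr eqxx.
  by rewrite mulr0.
rewrite (leq_trans (size_polyD _ _))// geq_max gs size_polyN.
rewrite big_seq; apply: (leq_trans (size_sum _ _ _)).
apply/bigmax_leqP_seq => x xs _; apply: (leq_trans (size_scale_leq _ _)).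
rewrite -big_filter size_prod_XsubC -(rem_filter x us).
by rewrite size_rem// prednK// -has_predT; apply/hasP; exists x.
Qed.

(** Compare coefficients of degree [size s - 1] in the interpolation formula: each product is monic
    of that degree, while [g] has a smaller one. *)
Lemma lagrange_sum0 s g : uniq s -> (size g < size s)%N ->
  \sum_(x <- s) g.[x] / \prod_(y <- s | y != x) (x - y) = 0.
Proof.
move=> us gs; have := lagrange_interpolation us (ltnW gs).
move=> /(congr1 (fun p : {poly K} => p`_(size s).-1)).
rewrite nth_default ?coef_sum; last by case: (s) gs.
move=> {2}->; rewrite [LHS]big_seq [RHS]big_seq; apply: eq_bigr => x xs.
set p := (X in _ *: X).
have -> : p = \prod_(y <- rem x s) ('X - y%:P) by rewrite rem_filter// big_filter.
rewrite coefZ; set q := \prod_(y <- rem x s) _.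
have -> : (size s).-1 = (size q).-1 by rewrite size_prod_XsubC size_rem.
rewrite -lead_coefE; have /monicP -> : q \is monic.
  by apply: monic_prod => *; rewrite monicXsubC.
by rewrite mulr1.
Qed.

(** Partial fractions: the interpolation formula at [t], divided by the full product over [s]. *)
Lemma lagrange_sum_div s g t : uniq s -> (size g <= size s)%N -> t \notin s ->
  \sum_(x <- s) g.[x] / \prod_(y <- s | y != x) (x - y) / (t - x) =
  g.[t] / \prod_(y <- s) (t - y).
Proof.
move=> us gs ts; rewrite [in RHS](lagrange_interpolation us gs) horner_sum.
rewrite mulr_suml [LHS]big_seq [RHS]big_seq; apply: eq_bigr => x xs.
rewrite hornerZ horner_prod_XsubC.
rewrite [X in _ = _ / X](bigD1_seq x)//= -[RHS]mulrA; congr (_ * _).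
rewrite invfM mulrCA divff ?mulr1//; rewrite prodf_seq_neq0.
apply/allP => y ys; apply/implyP => _; rewrite subr_eq0.
by apply: contraNneq ts => ->.
Qed.

End lagrange_interpolation.

Section real_sets.
Local Open Scope classical_set_scope.
Local Open Scope ring_scope.
Context {R : realType}.
Implicit Types (A B : set R) (F : R -> R).

(** The inequality is weak, so that the two sets may share an endpoint. *)
Definition le_set A B := forall a b, A a -> B b -> a <= b.

Lemma two_points A : infinite_set A -> exists a a', [/\ A a, A a' & a < a'].
Proof.
move=> /(@infinite_set_fset _ _ 2%N)[X XA X2].
have : (1 < size (finmap.enum_fset X))%N by exact: X2.
have := finmap.fset_uniq X.
have : forall x, x \in finmap.enum_fset X -> A x by move=> x; exact: XA.
case: (finmap.enum_fset X) => [//|a [//|b s]] h /=.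
rewrite inE negb_or => /andP[/andP[ab _] _] _.
have [Aa Ab] : A a /\ A b by split; apply: h; rewrite !inE eqxx ?orbT.
by move: ab; case: ltgtP => // ab _; [exists a, b|exists b, a].
Qed.

Lemma itv_overlap A B a a' b b' : is_interval A -> is_interval B ->
  A° `&` B° = set0 -> A a -> A a' -> B b -> B b' ->
  Num.max a b < Num.min a' b' -> False.
Proof.
move=> iA iB AB0 Aa Aa' Bb Bb' h.
(* The midpoint of the overlap of the two segments is interior to both intervals. *)
set c := (Num.max a b + Num.min a' b') / 2.
have [c1 c2] : Num.max a b < c /\ c < Num.min a' b' by rewrite /c; lra.
have : (A° `&` B°) c; last by rewrite AB0.
move: c1 c2; rewrite gt_max lt_min => /andP[ac bc] /andP[ca' cb'].
split.
  have cI : c \in `]a, a'[ by rewrite in_itv/= ac.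
  apply: filterS (near_in_itvoo cI) => z; rewrite in_itv/= => /andP[az za].
  by apply: (iA a a') => //; rewrite !ltW.
have cI : c \in `]b, b'[ by rewrite in_itv/= bc.
apply: filterS (near_in_itvoo cI) => z; rewrite in_itv/= => /andP[az za].
by apply: (iB b b') => //; rewrite !ltW.
Qed.

(** If both orders fail, there are [b < a] and [a' < b']. The segments they span overlap in an open
    interval, unless [a = a'] or [b = b']; a degenerate segment is then extended by one of two
    distinct points of the same infinite set. *)
Lemma le_set_total A B : is_interval A -> is_interval B ->
  infinite_set A -> infinite_set B -> A° `&` B° = set0 ->
  le_set A B \/ le_set B A.
Proof.
move=> iA iB /two_points[p [p' [Ap Ap' pp']]] /two_points[q [q' [Bq Bq' qq']]] AB0.
have ov a a' b b' : A a -> A a' -> B b -> B b' ->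
    a < a' -> a < b' -> b < a' -> b < b' -> False.
  move=> Aa Aa' Bb Bb' h1 h2 h3 h4; apply: (itv_overlap iA iB AB0 Aa Aa' Bb Bb').
  by rewrite gt_max !lt_min h1 h2 h3 h4.
have [|/existsNP[a /existsNP[b /not_implyP[Aa /not_implyP[Bb /negP]]]]] :=
  pselect (le_set A B); first by left.
rewrite -ltNge => ba; right => b' a' Bb' Aa'; rewrite leNgt; apply/negP => ab'.
have [a'a|aa'] := ltP a' a.
  have [bb'|] := ltP b b'; first exact: (ov a' a b b').
  rewrite le_eqVlt => /orP[/eqP e|b'b].
    move: ba; rewrite -e => ba {b Bb e}.
    have [|] := ltP b' q'; first by move=> ?; apply: (ov a' a b' q') => //; lra.
    by move=> h; apply: (ov a' a q b') => //; lra.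
  by apply: (ov a' a b' b) => //; lra.
move: aa'; rewrite le_eqVlt => /orP[/eqP e|aa'].
  move: ab'; rewrite -e => ab' {a' Aa' e}.
  have [|] := ltP a p'; first by move=> ?; apply: (ov a p' b b') => //; lra.
  by move=> h; apply: (ov p a b b') => //; lra.
by apply: (ov a a' b b') => //; lra.
Qed.

(** The witness [e] is a value of [F] (or 1 on an empty domain): values of opposite signs would
    force a zero between them. *)
Lemma continuous_nonvanishing_sign F D : is_interval D ->
  {within D, continuous F} -> (forall x, D x -> F x != 0) ->
  exists2 e : R, e != 0 & forall x, D x -> 0 <= e * F x.
Proof.
move=> iD cF F0.
have [[a Da]|nD] := pselect (exists a, D a); last first.
  by exists 1 => [|x Dx]; [exact: oner_neq0|case: nD; exists x].
exists (F a) => [|x Dx]; first exact: F0.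
rewrite leNgt; apply/negP => h.
have key u v : u <= v -> D u -> D v -> F u * F v < 0 -> False.
  move=> uv Du Dv uv0.
  have sub : `[u, v]%classic `<=` D.
    by move=> z /=; rewrite in_itv/= => ?; apply: (iD u v).
  have [|c cuv Fc0] := @IVT _ F u v 0 uv (continuous_subspaceW sub cF).
    rewrite ge_min le_max.
    have [?|?] := leP (F u) 0; have [?|?] := leP (F v) 0 => //=; nra.
  by have := F0 c (sub _ cuv); rewrite Fc0 eqxx.
have [ax|/ltW xa] := leP a x; first exact: key ax Da Dx h.
by apply: (key x a) => //; rewrite mulrC.
Qed.

(** Induction on the last point [z] of the list. To its left the induction hypothesis applies, to
    its right [F] keeps one sign, and [z] is put into [S] exactly when the two signs disagree. *)
Lemma sign_change_product F zs D : is_interval D ->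
  {within D, continuous F} -> sorted <%R zs ->
  (forall x, D x -> F x = 0 -> x \in zs) ->
  exists (c : R) (S : seq R), [/\ c != 0, subseq S zs &
    forall x, D x -> x \notin zs -> 0 <= c * \prod_(s <- S) (x - s) * F x].
Proof.
elim/last_ind: zs D => [|zs z IH] D iD cF szs Fz.
  have [|e e0 he] := continuous_nonvanishing_sign iD cF.
    by move=> x Dx; apply/eqP => /(Fz _ Dx).
  exists e, [::]; split=> // x Dx _; rewrite big_nil mulr1; exact: he.
have lez y : y \in zs -> y < z.
  move=> yzs; move: szs; rewrite (sorted_pairwise (@lt_trans _ _)) -cats1.
  by rewrite pairwise_cat allrel1r => /andP[/allP/(_ _ yzs)].
have szs' : sorted <%R zs.
  by move: szs => /(subseq_sorted (@lt_trans _ _)); apply; exact: subseq_rcons.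
have iDl : is_interval (D `&` [set x | x < z]).
  move=> x y [Dx xz] [Dy yz] t /andP[xt ty]; split; last exact: le_lt_trans ty yz.
  by apply: (iD x y) => //; rewrite xt.
have iDr : is_interval (D `&` [set x | z < x]).
  move=> x y [Dx xz] [Dy yz] t /andP[xt ty]; split; last exact: lt_le_trans xt.
  by apply: (iD x y) => //; rewrite xt.
have cW P : {within D `&` P, continuous F}.
  by apply: continuous_subspaceW cF => x [].
have [|c [S [c0 Szs hS]]] := IH _ iDl (cW _) szs'.
  move=> x [Dx xz] Fx0; have := Fz x Dx Fx0.
  by rewrite mem_rcons inE (lt_eqF xz).
have [|e e0 he] := continuous_nonvanishing_sign iDr (cW _).
  move=> x [Dx /= xz]; apply/eqP => /(Fz x Dx); rewrite mem_rcons inE (gt_eqF xz)/=.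
  by move=> /lez; rewrite ltNge (ltW xz).
have pz x : z < x -> 0 < \prod_(s <- S) (x - s).
  move=> zx; rewrite big_seq; apply: prodr_gt0 => s sS; rewrite subr_gt0.
  by apply: lt_trans zx; apply: lez; exact: (mem_subseq Szs).
have sgl x : D x -> x \notin rcons zs z -> x < z ->
    0 <= c * \prod_(s <- S) (x - s) * F x.
  move=> Dx; rewrite mem_rcons inE negb_or => /andP[_ xzs] xz.
  by apply: hS.
have sgr x : D x -> z < x -> 0 <= e * F x by move=> *; apply: he.
have [ce|ce] := ltP 0 (c * e).
  exists c, S; split=> //; first exact: (subseq_trans Szs (subseq_rcons _ _)).
  move=> x Dx xzs; have := xzs; rewrite mem_rcons inE negb_or => /andP[xz _].
  have [xz'|zx] := ltP x z; first exact: sgl.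
  have {}zx : z < x by rewrite lt_neqAle eq_sym xz.
  have := pz x zx; have := sgr x Dx zx => h1 h2.
  rewrite mulrAC pmulr_lge0//; nra.
(* The sign changes at [z]: the new factor [x - z] is negative on the left, which [- c] compensates,
   and positive on the right. *)
exists (- c), (rcons S z); split; first by rewrite oppr_eq0.
  by rewrite -!cats1 cat_subseq.
move=> x Dx xzs; have := xzs; rewrite mem_rcons inE negb_or => /andP[xz _].
rewrite big_rcons/=.
have [xz'|zx] := ltP x z.
  have := sgl x Dx xzs xz'; set P := \prod_(_ <- _) _ => h.
  have -> : - c * (P * (x - z)) * F x = (c * P * F x) * (z - x) by ring.
  by rewrite mulr_ge0// subr_ge0 ltW.
have {}zx : z < x by rewrite lt_neqAle eq_sym xz.
have := pz x zx; have := sgr x Dx zx => h1 h2.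
set P := \prod_(_ <- _) _ in h2 *.
have -> : - c * (P * (x - z)) * F x = (- c * F x) * (P * (x - z)) by ring.
have {}ce : c * e < 0 by rewrite lt_neqAle ce mulf_neq0.
apply: mulr_ge0; last by rewrite mulr_ge0 ?ltW// subr_gt0.
nra.
Qed.

(** Turns a bound on lists of zeros into one exhaustive list: an infinite set would contain [M]
    distinct points. *)
Lemma bounded_uniq_finite (Z : set R) M :
  (forall s, uniq s -> (forall x, x \in s -> Z x) -> (size s < M)%N) ->
  exists s, [/\ uniq s, (size s < M)%N & forall x, x \in s <-> Z x].
Proof.
move=> H; have [/finite_seqP[s sZ]|/(@infinite_set_fset _ _ M)[X XZ XM]] :=
  pselect (finite_set Z); last first.
  have := H _ (finmap.fset_uniq X) XZ.
  by rewrite ltnNge XM.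
have us := undup_uniq s.
have E x : x \in undup s <-> Z x by rewrite mem_undup sZ.
exists (undup s); split => //; apply: H => // x; exact: (E x).1.
Qed.

End real_sets.

(** * Measures of constant sign *)

Section ae_integrals.
Local Open Scope classical_set_scope.
Local Open Scope ring_scope.
Local Open Scope ereal_scope.
Context d (T : measurableType d) (R : realType).
Implicit Types (mu : {measure set T -> \bar R}) (f g w : T -> \bar R).

Lemma signE (e : bool) (x : \bar R) :
  ((-1) ^+ e)%:E * x = if e then - x else x.
Proof. by case: e; rewrite ?expr1 ?expr0 ?mul1e ?EFinN ?mulN1e. Qed.

Lemma signMM (e : bool) (x : \bar R) :
  ((-1) ^+ e)%:E * (((-1) ^+ e)%:E * x) = x.
Proof. by rewrite !signE; case: e; rewrite ?oppeK. Qed.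

(** A finite integral leaves no room for an infinite positive or negative part, because [+oo - +oo]
    is again infinite. *)
Lemma fin_num_integrable mu f : measurable_fun setT f ->
  \int[mu]_t f t \is a fin_num -> mu.-integrable setT f.
Proof.
move=> mf If; apply/integrableP; split => //.
by apply/abse_integralP => //; rewrite -ge0_fin_numE ?abse_fin_num.
Qed.

Lemma ae_integral_ge0 mu f : measurable_fun setT f ->
  {ae mu, forall t, 0 <= f t} -> 0 <= \int[mu]_t f t.
Proof.
move=> mf f0; rewrite (ae_eq_integral (fun t => `|f t|)) //.
- by apply: integral_ge0 => t _; rewrite abse_ge0.
- exact: measurableT_comp.
- by apply: filterS f0 => t f0 _; rewrite gee0_abs.
Qed.

Lemma ae_integral_le0 mu f : measurable_fun setT f ->
  {ae mu, forall t, f t <= 0} -> \int[mu]_t f t <= 0.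
Proof.
move=> mf f0; rewrite (ae_eq_integral (fun t => - `|f t|)) //.
- rewrite integral_ge0N => [|t _]; last exact: abse_ge0.
  by rewrite oppe_le0 integral_ge0 => // t _; exact: abse_ge0.
- by apply: measurableT_comp => //; exact: measurableT_comp.
- by apply: filterS f0 => t f0 _; rewrite lee0_abs// oppeK.
Qed.

Lemma ae_eq_integrable mu f g : measurable_fun setT f ->
  {ae mu, forall t, f t = g t} -> mu.-integrable setT g ->
  mu.-integrable setT f.
Proof.
move=> mf fg /integrableP[mg Ig]; apply/integrableP; split => //.
rewrite (ae_eq_integral (fun t => `|g t|))//.
- exact: measurableT_comp.
- exact: measurableT_comp.
- by apply: filterS fg => t ->.
Qed.

Lemma ae_bounded_integrable (mu : {finite_measure set T -> \bar R}) f (M : R) :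
  measurable_fun setT f -> {ae mu, forall t, `|f t| <= M%:E} ->
  mu.-integrable setT f.
Proof.
move=> mf fM; apply/integrableP; split => //.
have /integrableP[_] := finite_measure_integrable_cst mu M measurableT.
apply: le_lt_trans; apply: ae_ge0_le_integral => //.
- exact: measurableT_comp.
- by apply: measurableT_comp => //; exact/measurable_EFinP/measurable_cst.
- by apply: filterS fM => t fM _; apply: (le_trans fM); rewrite /= lee_fin ler_norm.
Qed.

Section density.
Variables (lam lam' : {finite_measure set T -> \bar R}) (g : T -> \bar R).
Hypotheses (mg : measurable_fun setT g) (g0 : forall t, 0 <= g t).
Hypothesis lamE : forall A, measurable A -> lam' A = \int[lam]_(t in A) g t.

Lemma density_dominates : lam' `<< lam.
Proof.
apply/null_content_dominatesP => A mA A0.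
by rewrite lamE// null_set_integral//; exact: measurable_funTS.
Qed.

(** The change of variables for the Radon-Nikodym derivative carries over to [g]: the two agree
    almost everywhere, having the same integral over every measurable set. *)
Lemma ge0_integral_density f : measurable_fun setT f ->
  (forall t, 0 <= f t) -> \int[lam']_t f t = \int[lam]_t (f t * g t).
Proof.
move=> mf f0; have ll := density_dominates.
rewrite -(Radon_Nikodym_SigmaFinite.change_of_variables (mu := lam))//.
have irn := Radon_Nikodym_SigmaFinite.f_integrable ll.
apply: ae_eq_integral => //.
- by apply: emeasurable_funM => //; exact: measurable_int irn.
- exact: emeasurable_funM.
- apply: ae_eqe_mul2l; apply: integral_ae_eq => // E _ mE.
  by rewrite -lamE// -Radon_Nikodym_SigmaFinite.f_integral.
Qed.

Lemma integrable_density f :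
  lam'.-integrable setT f -> lam.-integrable setT (fun t => f t * g t).
Proof.
move=> /integrableP[mf If]; apply/integrableP; split; first exact: emeasurable_funM.
under eq_integral do rewrite abseM (gee0_abs (g0 _)).
by rewrite -ge0_integral_density//; exact: measurableT_comp.
Qed.

Lemma integral_density f : lam'.-integrable setT f ->
  \int[lam']_t f t = \int[lam]_t (f t * g t).
Proof.
move=> fi; have mf := measurable_int _ fi.
rewrite integralE [RHS]integralE.
rewrite !ge0_integral_density//; [|exact: measurable_funeneg|exact: measurable_funepos].
have maxM x t : maxe x 0 * g t = maxe (x * g t) 0.
  have [x0|/ltW x0] := leP 0 x; first by rewrite !max_l// mule_ge0.
  by rewrite !max_r ?mul0e// mule_le0_ge0.
congr (_ - _); apply: eq_integral => t _.
  by rewrite !funeposE maxM.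
by rewrite !funenegE maxM mulNe.
Qed.

End density.

Section signed_density.
Variables (lam : {finite_measure set T -> \bar R}) (w : T -> \bar R) (e : bool).
Hypothesis iw : lam.-integrable setT w.
Hypothesis we : {ae lam, forall t, 0 <= ((-1) ^+ e)%:E * w t}.

Let wE : {ae lam, forall t, w t = ((-1) ^+ e)%:E * `|w t|}.
Proof.
apply: filterS we => t; rewrite !signE; case: (e) => wt.
  by rewrite -abseN gee0_abs// oppeK.
by rewrite gee0_abs.
Qed.

Let mw : measurable_fun setT w := measurable_int _ iw.

Let mabs : measurable_fun setT (fun t => `|w t|).
Proof. exact: measurableT_comp. Qed.

Lemma integral_sign_abs A : measurable A ->
  \int[lam]_(t in A) w t = ((-1) ^+ e)%:E * \int[lam]_(t in A) `|w t|.
Proof.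
move=> mA; have iwA : lam.-integrable A (fun t => `|w t|).
  by apply: integrable_abse; exact: integrableS iw.
rewrite -integralZl//; apply: ae_eq_integral => //.
- exact: measurable_funTS.
- by apply: measurable_funTS; exact: measurable_funeM.
- by apply: filterS wE.
Qed.

(** Almost everywhere [w] is [(-1) ^+ e] times [|w|], so the nonnegative density [|w|] does the work
    and the sign comes out of the integral. *)
Lemma integral_signed_density (lam' : {finite_measure set T -> \bar R}) f :
  (forall A, measurable A -> lam' A = \int[lam]_(t in A) `|w t|) ->
  lam'.-integrable setT f ->
  lam.-integrable setT (fun t => f t * w t) /\
  \int[lam]_t (f t * w t) = ((-1) ^+ e)%:E * \int[lam']_t f t.
Proof.
move=> lE fi; have mf := measurable_int _ fi.
have w0 t : 0 <= `|w t| by exact: abse_ge0.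
have ifw := integrable_density mabs w0 lE fi.
have fwE : {ae lam, forall t, f t * w t = ((-1) ^+ e)%:E * (f t * `|w t|)}.
  by apply: filterS wE => t wE'; rewrite [in LHS]wE' muleCA.
have mfw : measurable_fun setT (fun t => f t * w t) by exact: emeasurable_funM.
have iefw := integrableZl measurableT ((-1) ^+ e)%R ifw.
split; first exact: ae_eq_integrable fwE iefw.
rewrite (integral_density mabs w0 lE fi) -integralZl//.
apply: ae_eq_integral => //; first exact: measurable_int iefw.
by apply: filterS fwE.
Qed.

End signed_density.

End ae_integrals.

Section constant_sign_charges.
Local Open Scope classical_set_scope.
Local Open Scope ring_scope.
Local Open Scope ereal_scope.
Context {R : realType}.
Local Notation finmeas := {finite_measure set (measurableTypeR R) -> \bar R}.
Implicit Types (nu : borel_charge R) (lam : finmeas) (b : bool).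
Implicit Types (A B : set (measurableTypeR R)) (f g : measurableTypeR R -> \bar R).

(* [filterS] does not apply here: [measurableTypeR R] and [R] carry the same
   sigma-algebra through structures that unification does not identify. *)
Lemma ae_impl lam (P Q : R -> Prop) : (forall t, P t -> Q t) ->
  {ae lam, forall t, P t} -> {ae lam, forall t, Q t}.
Proof.
move=> PQ [N [mN N0 PN]]; exists N; split => // t nQ; apply: PN => Pt.
by apply: nQ; exact: PQ.
Qed.

Lemma ae_impl2 lam (P Q S : R -> Prop) : (forall t, P t -> Q t -> S t) ->
  {ae lam, forall t, P t} -> {ae lam, forall t, Q t} -> {ae lam, forall t, S t}.
Proof.
move=> PQS [N [mN N0 PN]] [M [mM M0 QM]]; exists (N `|` M); split.
- exact: measurableU.
- exact: null_set_setU.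
- move=> t nS; have [Nt|nNt] := pselect (N t); [by left|right; apply: QM => Qt].
  by apply: nNt; apply: PN => Pt; apply: nS; exact: PQS.
Qed.

Lemma ae_seq lam (I : eqType) (s : seq I) (P : I -> R -> Prop) :
  (forall i, i \in s -> {ae lam, forall t, P i t}) ->
  {ae lam, forall t, forall i, i \in s -> P i t}.
Proof.
elim: s => [_|i s IH Ps]; first by apply: aeW.
have {}IH : {ae lam, forall t, forall i, i \in s -> P i t}.
  by apply: IH => j js; apply: Ps; rewrite inE js orbT.
apply: (ae_impl2 _ (Ps i (mem_head _ _)) IH) => t Pi H j.
by rewrite inE => /predU1P[->//|]; exact: H.
Qed.

(** A charge of constant sign becomes a boolean sign and a finite measure, so that signs multiply by
    exclusive or and integrals are taken against measures only. *)
Definition represents nu b lam := forall A, measurable A ->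
  nu A = ((-1) ^+ b)%:E * lam A.

(** Whatever Hahn decomposition was chosen, [lam] vanishes on its set of the wrong sign, since [nu]
    has there both signs at once. *)
Lemma represents_jordan nu b lam A : represents nu b lam -> measurable A ->
  pos_part nu A = (if b then 0 else lam A) /\
  neg_part nu A = (if b then lam A else 0).
Proof.
move=> nulam mA; rewrite /pos_part /neg_part.
case: (svalP (hahn_pair nu)) => posP negN PNT PN0.
set P := (sval _).1 in posP PNT PN0 *; set N := (sval _).2 in negN PNT PN0 *.
have mP : measurable P by case: posP.
have mN : measurable N by case: negN.
rewrite jordan_posE jordan_negE cjordan_posE cjordan_negE /crestr0 mem_set//=.
rewrite /crestr.
have mAP : measurable (A `&` P) by exact: measurableI.
have mAN : measurable (A `&` N) by exact: measurableI.
have [_ /(_ _ mAP (@subIsetr _ _ _))] := posP.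
have [_ /(_ _ mAN (@subIsetr _ _ _))] := negN.
have : lam A = lam (A `&` P) + lam (A `&` N).
  rewrite -measureU// ?setIUr -?setIUr ?PNT ?setIT//.
  by rewrite setIACA PN0 setI0.
have := measure_ge0 lam (A `&` P); have := measure_ge0 lam (A `&` N).
rewrite !nulam// !signE => p0 n0 ->.
case: b {nulam} => [h h'|h h'].
- have -> : lam (A `&` P) = 0 by apply/eqP; rewrite eq_le n0 andbT -oppe_ge0.
  by rewrite oppe0 oppeK add0e.
- have -> : lam (A `&` N) = 0 by apply/eqP; rewrite eq_le p0 andbT.
  by rewrite oppe0 adde0.
Qed.

(** The measure is one of the two Jordan parts; the other one vanishes. *)
Lemma sign_represents nu b :
  (forall A, measurable A -> 0 <= ((-1) ^+ b)%:E * nu A) ->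
  exists lam, represents nu b lam.
Proof.
have J A : measurable A -> nu A = pos_part nu A - neg_part nu A.
  move=> mA; have := jordan_decomp (svalP (hahn_pair nu)) mA.
  by rewrite /cadd/= cscaleN1.
case: b => nub; [exists (neg_part nu : finmeas)|exists (pos_part nu : finmeas)];
    move=> A mA; rewrite signE J//.
- suff -> : pos_part nu A = 0 by rewrite add0e.
  have {}nub B : measurable B -> 0 <= - nu B by move=> /nub; rewrite signE.
  move: nub; rewrite /pos_part; case: (svalP (hahn_pair nu)) => posP negN PNT PN0.
  rewrite jordan_posE cjordan_posE /crestr0 mem_set//= /crestr => nub.
  have mP : measurable (sval (hahn_pair nu)).1 by case: posP.
  have mAP : measurable (A `&` (sval (hahn_pair nu)).1) by exact: measurableI.
  have h : 0 <= nu (A `&` (sval (hahn_pair nu)).1) by apply: posP.2 => //; exact: subIsetr.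
  by apply/eqP; rewrite eq_le h andbT -oppe_ge0; exact: nub.
- suff -> : neg_part nu A = 0 by rewrite sube0.
  have {}nub B : measurable B -> 0 <= nu B by move=> /nub; rewrite signE.
  move: nub; rewrite /neg_part; case: (svalP (hahn_pair nu)) => posP negN PNT PN0.
  rewrite jordan_negE cjordan_negE /crestr0 mem_set//= /crestr => nub.
  have mN : measurable (sval (hahn_pair nu)).2 by case: negN.
  have mAN : measurable (A `&` (sval (hahn_pair nu)).2) by exact: measurableI.
  have h : nu (A `&` (sval (hahn_pair nu)).2) <= 0 by apply: negN.2 => //; exact: subIsetr.
  have h' := nub _ mAN.
  by apply/eqP; rewrite oppe_eq0 eq_le h h'.
Qed.

Lemma constant_sign_represents nu : constant_sign nu ->
  exists b lam, represents nu b lam.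
Proof.
case=> h; [exists false|exists true]; apply: sign_represents => A mA.
  by rewrite signE h.
by rewrite signE oppe_ge0 h.
Qed.

Lemma integrable_eq_measure (lam lam' : {measure set (measurableTypeR R) -> \bar R}) f :
  (forall A, measurable A -> lam A = lam' A) ->
  lam.-integrable setT f -> lam'.-integrable setT f.
Proof.
move=> h /integrableP[mf fi]; apply/integrableP; split => //.
by rewrite (eq_measure_integral lam) => // A mA _; rewrite h.
Qed.

Lemma integrable_measure0 (lam : {measure set (measurableTypeR R) -> \bar R}) f :
  (forall A, measurable A -> lam A = 0) ->
  measurable_fun setT f -> lam.-integrable setT f.
Proof.
move=> h mf; apply/integrableP; split => //.
rewrite (eq_measure_integral mzero) => [|A mA _]; last by rewrite h.
by rewrite integral_measure_zero.
Qed.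

Lemma represents_integrable nu b lam f : represents nu b lam ->
  cintegrable nu f <-> lam.-integrable setT f.
Proof.
move=> h.
have hp A : measurable A -> pos_part nu A = (if b then 0 else lam A).
  by move=> mA; have [] := represents_jordan h mA.
have hn A : measurable A -> neg_part nu A = (if b then lam A else 0).
  by move=> mA; have [] := represents_jordan h mA.
case: b {h} hp hn => hp hn; split.
- by case=> _; exact: integrable_eq_measure.
- move=> fi; split; first by apply: integrable_measure0 => //; exact: measurable_int fi.
  by apply: integrable_eq_measure fi => A mA; exact/esym/hn.
- by case=> + _; exact: integrable_eq_measure.
- move=> fi; split; last by apply: integrable_measure0 => //; exact: measurable_int fi.
  by apply: integrable_eq_measure fi => A mA; exact/esym/hp.
Qed.

Lemma represents_integral nu b lam A f : represents nu b lam -> measurable A ->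
  cintegral nu A f = ((-1) ^+ b)%:E * \int[lam]_(t in A) f t.
Proof.
move=> h mA; rewrite /cintegral signE.
case: b h => h.
- rewrite (eq_measure_integral mzero) => [|B mB _]; last first.
    by have [] := represents_jordan h mB.
  rewrite integral_measure_zero (eq_measure_integral lam) ?add0e// => B mB _.
  by have [] := represents_jordan h mB.
- rewrite [X in _ - X](eq_measure_integral mzero) => [|B mB _]; last first.
    by have [] := represents_jordan h mB.
  rewrite integral_measure_zero (eq_measure_integral lam) ?sube0// => B mB _.
  by have [] := represents_jordan h mB.
Qed.

Lemma represents_csupport nu b lam : represents nu b lam ->
  csupport nu = [set x | forall U : set R, open U -> U x -> lam U != 0].
Proof.
move=> h; rewrite /csupport; congr mkset; apply/funext => x; apply/propext.
have E U : open U -> pos_part nu U + neg_part nu U = lam U.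
  move=> oU; have [-> ->] := represents_jordan h (open_measurable oU).
  by case: (b); rewrite ?add0e ?adde0.
by split => H U oU Ux; [rewrite -E//|rewrite E//]; exact: H.
Qed.

(** Each point outside the support lies in a null interval with rational endpoints, and there are
    countably many of these. *)
Lemma represents_ae_csupport nu b lam : represents nu b lam ->
  {ae lam, forall x, csupport nu x}.
Proof.
move=> h; rewrite (represents_csupport h).
pose J (pq : rat * rat) : set R := `]ratr pq.1, ratr pq.2[%classic.
pose F n : set R := if unpickle n is Some pq then
  (if `[< lam (J pq) = 0 >] then J pq else set0) else set0.
apply: (@negligibleS _ _ _ lam (\bigcup_n F n)); last first.
  apply: negligible_bigcup => n; rewrite /F.
  case: (unpickle n) => [pq|]; last exact: negligible_set0.
  case: asboolP => J0; last exact: negligible_set0.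
  by apply/negligibleP => //; exact: measurable_itv.
move=> x /= /existsNP[U /not_implyP[oU /not_implyP[Ux /negP]]].
rewrite negbK => /eqP U0.
have [e /= e0 eU] : nbhs_ball x U by apply/nbhs_ballP; exact: open_nbhs_nbhs.
have [p] := @rat_in_itvoo R (x - e)%R x ltac:(lra).
have [q] := @rat_in_itvoo R x (x + e)%R ltac:(lra).
rewrite !in_itv/= => /andP[xq qe] /andP[ep px].
exists (pickle (p, q)); first exact: I.
rewrite /F pickleK.
have JU : J (p, q) `<=` U.
  move=> t; rewrite /J/= in_itv/= => /andP[pt tq]; apply: eU.
  by rewrite /ball/= ltr_norml; apply/andP; split; lra.
case: asboolP => [_|]; first by rewrite /J/= in_itv/= px xq.
case; apply/eqP; rewrite eq_le measure_ge0 andbT -U0.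
by apply: le_measure; rewrite ?inE//; [exact: measurable_itv|exact: open_measurable].
Qed.

(** The complement of a finite set carrying [lam] is open and null, hence misses the support. *)
Lemma ae_finite_csupport nu b lam (E : seq R) : represents nu b lam ->
  {ae lam, forall t, t \in E} -> finite_set (csupport nu).
Proof.
move=> h lE; apply: (@sub_finite_set _ _ [set` E]); last exact: finite_seq.
move=> x; rewrite (represents_csupport h) => H; apply: contrapT => /= xE.
have oU : open (~` [set` E] : set R).
  apply: closed_openC.
  have /accessible_finite_set_closed : accessible_space R.
    exact/hausdorff_accessible/Rhausdorff.
  by apply; exact: finite_seq.
have /eqP := H _ oU xE; apply.
by apply: measure_negligible; [exact: open_measurable|exact: lE].
Qed.

Lemma dominates_ae (lam lam' : finmeas) (P : R -> Prop) : lam' `<< lam ->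
  {ae lam, forall t, P t} -> {ae lam', forall t, P t}.
Proof.
by move=> /null_content_dominatesP ll [N [mN N0 PN]]; exists N; split => //; exact: ll.
Qed.

Lemma csupport_separated b lam nu x : represents nu b lam -> ~ csupport nu x ->
  exists2 d : R, (0 < d)%R & {ae lam, forall t, (d <= `|t - x|)%R}.
Proof.
move=> h; rewrite (represents_csupport h).
move=> /existsNP[U /not_implyP[oU /not_implyP[Ux /negP]]]; rewrite negbK => /eqP U0.
have [e /= e0 eU] : nbhs_ball x U by apply/nbhs_ballP; exact: open_nbhs_nbhs.
exists e => //; exists U; split => //; first exact: open_measurable.
move=> t /= /negP; rewrite -ltNge => te; apply: eU.
by rewrite /ball/= distrC.
Qed.

End constant_sign_charges.

(** * Cauchy transforms and brackets *)

Section cauchy_kernel.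
Local Open Scope classical_set_scope.
Local Open Scope ring_scope.
Local Open Scope ereal_scope.
Context {R : realType}.
Local Notation T := (measurableTypeR R).
Local Notation finmeas := {finite_measure set (measurableTypeR R) -> \bar R}.
Implicit Types (nu : borel_charge R) (lam : finmeas) (b : bool).

(* Equal to +oo at t = x, so that its integrability excludes an atom at x. *)
Definition cauchy_kernel (x t : R) : \bar R := ((t - x)%:E)^-1.

Lemma cauchy_kernelE x t : t != x -> cauchy_kernel x t = ((t - x)^-1)%:E.
Proof. by move=> tx; rewrite /cauchy_kernel inver subr_eq0 (negbTE tx). Qed.

Lemma cauchy_kernelxx x : cauchy_kernel x x = +oo.
Proof. by rewrite /cauchy_kernel subrr inve0. Qed.

Lemma measurable_cauchy_kernel x :
  measurable_fun [set: T] (cauchy_kernel x : T -> \bar R).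
Proof.
have -> : cauchy_kernel x = fun t => if t == x then +oo else ((t - x)^-1)%:E.
  apply/funext => t; case: eqVneq => [->|]; first exact: cauchy_kernelxx.
  exact: cauchy_kernelE.
apply: measurable_fun_if => //.
  apply: (measurable_fun_bool true).
  rewrite setTI (_ : _ @^-1` _ = [set x]); last first.
    by apply/seteqP; split => t /=; [move/eqP|move=> ->; rewrite eqxx].
  exact: measurable_set1.
have -> : setT `&` (fun t : R => t == x) @^-1` [set false] = ~` [set x].
  by rewrite setTI; apply/seteqP; split => t /=; [move/eqP|move/eqP/negbTE].
apply/measurable_EFinP; apply: open_continuous_measurable_fun.
  by apply: closed_openC; exact: closed_eq.
move=> t; rewrite inE => /= /eqP tx; apply: cvgV; rewrite ?subr_eq0//.
by apply: cvgB; [exact: cvg_id|exact: cvg_cst].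
Qed.

Lemma m_functionE nu b lam x : represents nu b lam ->
  m_function nu x = ((-1) ^+ b)%:E * \int[lam]_t cauchy_kernel x t.
Proof. by move=> h; rewrite /m_function (represents_integral _ h). Qed.

Lemma m_function_fin_numP nu b lam x : represents nu b lam ->
  (m_function nu x \is a fin_num) <-> lam.-integrable setT (cauchy_kernel x).
Proof.
move=> h; rewrite (m_functionE x h) signE.
rewrite (_ : (if b then _ else _) \is a fin_num =
  (\int[lam]_t cauchy_kernel x t \is a fin_num)); last by case: b {h}; rewrite ?fin_numN.
split; first by apply: fin_num_integrable; exact: measurable_cauchy_kernel.
by move=> ?; apply: integrable_fin_num.
Qed.

Lemma integrable_cauchy_kernel_neq lam x :
  lam.-integrable setT (cauchy_kernel x) -> {ae lam, forall t, t != x}.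
Proof.
move=> /(integrable_ae measurableT); apply: ae_impl => t /(_ I).
by apply: contraTneq => ->; rewrite cauchy_kernelxx.
Qed.

Lemma cauchy_integral_ge0 lam x :
  {ae lam, forall t, (x <= t)%R} -> 0 <= \int[lam]_t cauchy_kernel x t.
Proof.
move=> xt; apply: ae_integral_ge0; first exact: measurable_cauchy_kernel.
by apply: (ae_impl _ xt) => t {}xt; rewrite inve_ge0 lee_fin subr_ge0.
Qed.

Lemma cauchy_integral_le0 lam x :
  lam.-integrable setT (cauchy_kernel x) ->
  {ae lam, forall t, (t <= x)%R} -> \int[lam]_t cauchy_kernel x t <= 0.
Proof.
move=> ix tx; apply: ae_integral_le0; first exact: measurable_cauchy_kernel.
apply: (ae_impl2 _ tx (integrable_cauchy_kernel_neq ix)) => t {}tx tnx.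
by rewrite cauchy_kernelE// lee_fin invr_le0 subr_le0.
Qed.

(** The kernel has the sign of [t - x], which is fixed when [A] and [B] lie on opposite sides of
    each other. *)
Lemma m_function_constant_sign nu b lam A B : represents nu b lam ->
  {ae lam, forall t, B t} -> le_set A B \/ le_set B A ->
  exists e : bool, forall x, A x -> m_function nu x \is a fin_num ->
    0 <= ((-1) ^+ e)%:E * m_function nu x.
Proof.
move=> h lB [AB|BA]; [exists b|exists (~~ b)] => x Ax.
  move=> _; rewrite (m_functionE x h) muleA -EFinM -signr_addb addbb expr0 mul1e.
  by apply: cauchy_integral_ge0; apply: (ae_impl _ lB) => t Bt; exact: AB.
(* For [t <= x] the value [+oo] of the kernel at [t = x] has the wrong sign; finiteness rules out an
   atom at [x]. *)
move=> /(m_function_fin_numP x h) ix.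
rewrite (m_functionE x h) muleA -EFinM -signr_addb addNb addbb/=.
rewrite EFinN mulN1e oppe_ge0; apply: cauchy_integral_le0 => //.
by apply: (ae_impl _ lB) => t Bt; exact: BA.
Qed.

Lemma bracketE s1 s2 b lam A : represents s1 b lam -> bracket_defined s1 s2 ->
  measurable A ->
  bracket s1 s2 A = ((-1) ^+ b)%:E * \int[lam]_(t in A) m_function s2 t.
Proof.
by move=> h d mA; rewrite /bracket cdensityE// (represents_integral _ h).
Qed.

(** The bracket has density [m_function s2] with respect to [s1]; its sign joins that of [s1], and
    [lam'] is the absolute value of this density times [lam]. The last clause is the resulting
    change of variables. *)
Lemma bracket_represents s1 s2 b lam (e : bool) : represents s1 b lam ->
  bracket_defined s1 s2 ->
  {ae lam, forall t, 0 <= ((-1) ^+ e)%:E * m_function s2 t} ->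
  exists lam', [/\ represents (bracket s1 s2) (b (+) e) lam',
    lam' `<< lam &
    forall f : T -> \bar R, lam'.-integrable setT f ->
      lam.-integrable setT (fun t => f t * m_function s2 t) /\
      ((-1) ^+ (b (+) e))%:E * \int[lam']_t f t =
      ((-1) ^+ b)%:E * \int[lam]_t (f t * m_function s2 t)].
Proof.
move=> h d we; pose w : T -> \bar R := m_function s2.
have iw : lam.-integrable setT w by move: d => /(represents_integrable _ h).
have mabs : measurable_fun [set: T] (fun t => `|w t|).
  by apply: measurableT_comp => //; exact: measurable_int iw.
have brE A : measurable A ->
    bracket s1 s2 A = ((-1) ^+ (b (+) e))%:E * \int[lam]_(t in A) `|w t|.
  move=> mA; rewrite (bracketE h d mA) signr_addb EFinM -muleA; congr (_ * _).
  exact: (integral_sign_abs iw we mA).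
have [lam' h'] : exists lam', represents (bracket s1 s2) (b (+) e) lam'.
  apply: sign_represents => A mA; rewrite brE// signMM.
  by apply: integral_ge0 => t _; exact: abse_ge0.
(* Cancelling the sign identifies [lam'] as the measure of density [|w|]. *)
have lE A : measurable A -> lam' A = \int[lam]_(t in A) `|w t|.
  move=> mA; have := h' A mA; rewrite brE// => /(congr1 (mule ((-1) ^+ (b (+) e))%:E)).
  by rewrite !signMM.
exists lam'; split => //; first exact: (density_dominates mabs lE).
move=> f fi; have [? ->] := integral_signed_density iw we lE fi.
by split => //; rewrite signr_addb EFinM -muleA.
Qed.

Lemma integrable_cauchy_kernel_sep lam x (d : R) : (0 < d)%R ->
  {ae lam, forall t, (d <= `|t - x|)%R} -> lam.-integrable setT (cauchy_kernel x).
Proof.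
move=> d0 dx.
apply: (@ae_bounded_integrable _ _ _ _ _ d^-1%R); first exact: measurable_cauchy_kernel.
apply: (ae_impl _ dx) => t {}dx.
have tx : t != x by rewrite -subr_eq0 -normr_gt0 (lt_le_trans d0).
rewrite cauchy_kernelE//= lee_fin normfV lef_pV2 ?posrE//.
exact: lt_le_trans dx.
Qed.

(** Dominated convergence: the comparison of distances bounds every kernel along the sequence by
    twice the absolute value of the integrable kernel at [x0]. *)
Lemma m_function_cvg nu b lam (D : set R) x0 (d : R) (u : R^nat) :
  represents nu b lam -> lam.-integrable setT (cauchy_kernel x0) ->
  {ae lam, forall t, forall x, D x -> (`|x - x0| < d)%R ->
    (`|t - x0| <= 2 * `|t - x|)%R} ->
  (forall n, D (u n) /\ (`|u n - x0| < d)%R) -> u @ \oo --> x0 ->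
  (fine \o m_function nu \o u) @ \oo --> fine (m_function nu x0).
Proof.
move=> h ix sep Du ux.
have [|||||_ _ cvI] := @dominated_convergence _ _ _ lam setT measurableT
    (fun n => cauchy_kernel (u n)) (cauchy_kernel x0)
    (fun t => 2%:E * `|cauchy_kernel x0 t|).
- by move=> n; exact: measurable_cauchy_kernel.
- exact: measurable_cauchy_kernel.
- apply: (ae_impl2 _ sep (integrable_cauchy_kernel_neq ix)) => t {}sep tx _.
  have tu n : t != u n.
    have [Dn dn] := Du n; have := sep _ Dn dn.
    rewrite -[t == u n]subr_eq0 -normr_gt0.
    have : (0 < `|t - x0|)%R by rewrite normr_gt0 subr_eq0.
    by move=> *; lra.
  under eq_fun do rewrite cauchy_kernelE//.
  rewrite cauchy_kernelE//; apply: cvg_EFin; first by near=> n.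
  by apply: cvgV; rewrite ?subr_eq0//; apply: cvgB => //; exact: cvg_cst.
- by apply: integrableZl => //; exact: integrable_abse.
- apply: (ae_impl2 _ sep (integrable_cauchy_kernel_neq ix)) => t {}sep tx n _.
  have [Dn dn] := Du n; have h1 := sep _ Dn dn.
  have h2 : (0 < `|t - x0|)%R by rewrite normr_gt0 subr_eq0.
  have tu : t != u n by rewrite -[t == u n]subr_eq0 -normr_gt0; lra.
  rewrite !cauchy_kernelE//= -EFinM lee_fin !normfV.
  rewrite -[2%R in leRHS]invrK -invfM lef_pV2 ?posrE; first by lra.
  - by rewrite normr_gt0 subr_eq0.
  - by lra.
have fI : \int[lam]_t cauchy_kernel x0 t \is a fin_num by exact: integrable_fin_num.
have {}cvI : (fun n => ((-1) ^+ b)%:E * \int[lam]_t cauchy_kernel (u n) t) @ \oo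
    --> ((-1) ^+ b)%:E * \int[lam]_t cauchy_kernel x0 t by exact: cvgeZl.
have -> : fine \o m_function nu \o u =
    fine \o (fun n => ((-1) ^+ b)%:E * \int[lam]_t cauchy_kernel (u n) t).
  by apply/funext => n /=; rewrite (m_functionE _ h).
rewrite (m_functionE _ h); apply: fine_cvg; rewrite fineK//.
by rewrite fin_numM.
Unshelve. all: by end_near. Qed.

End cauchy_kernel.

(** * Continuity on subsets of the line *)

Section within_continuity.
Local Open Scope classical_set_scope.
Local Open Scope ring_scope.
Context {R : realType}.

(** A discontinuity at [x0] yields, by choice, points of [D] converging to [x0] whose images stay at
    distance at least [e] from [f x0]. *)
Lemma within_continuous_seq (f : R -> R) (D : set R) :
  (forall x0, D x0 -> exists2 d : R, 0 < d & forall u : R^nat,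
    (forall n, D (u n) /\ `|u n - x0| < d) -> u @ \oo --> x0 ->
    (f \o u) @ \oo --> f x0) ->
  {within D, continuous f}.
Proof.
move=> H; apply/subspace_continuousP => x0 Dx0; have [d d0 Hd] := H x0 Dx0.
apply/cvgrPdist_lt => e e0; rewrite /prop_near1 /= nbhs_simpl /within/=.
apply: contrapT => nN.
have P (n : nat) : exists x, [/\ D x, `|x - x0| < Num.min d n.+1%:R^-1 & e <= `|f x0 - f x|].
  apply: contrapT => nP; apply: nN.
  have m0 : 0 < Num.min d n.+1%:R^-1 by rewrite lt_min d0 invr_gt0 ltr0n.
  apply/nbhs_ballP; exists (Num.min d n.+1%:R^-1) => //= x xb Dx.
  rewrite ltNge; apply/negP => ef; apply: nP; exists x; split => //.
  by rewrite distrC.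
have [u uP] := choice P.
have Du n : D (u n) /\ `|u n - x0| < d.
  by have [? + _] := uP n; rewrite lt_min => /andP[].
have ux : u @ \oo --> x0.
  apply/cvgrPdist_lt => e' e'0; near=> n.
  have [_ + _] := uP n; rewrite lt_min distrC => /andP[_ /lt_trans]; apply.
  by near: n; exact: near_infty_natSinv_lt (PosNum e'0).
have /cvgrPdist_lt/(_ e e0) := Hd u Du ux.
move=> [n _ /(_ n (leqnn n))] /=.
by have [_ _] := uP n; rewrite leNgt => /negP.
Unshelve. all: by end_near. Qed.

Lemma within_continuousM (f g : R -> R) (A : set R) :
  {within A, continuous f} -> {within A, continuous g} ->
  {within A, continuous (fun x => f x * g x)}.
Proof. by move=> cf cg x; apply: continuousM; [exact: cf|exact: cg]. Qed.

Lemma within_continuous_sum (I : eqType) (s : seq I) (P : pred I)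
    (f : I -> R -> R) (D : set R) :
  (forall i, i \in s -> P i -> {within D, continuous (f i)}) ->
  {within D, continuous (fun x => \sum_(i <- s | P i) f i x)}.
Proof.
elim: s => [_|i s IH fs].
  by under eq_fun do rewrite big_nil; apply: continuous_subspaceT => x; exact: cvg_cst.
have {}IH : {within D, continuous (fun x => \sum_(i <- s | P i) f i x)}.
  by apply: IH => j js; apply: fs; rewrite inE js orbT.
under eq_fun do rewrite big_cons.
have [Pi|//] := boolP (P i).
have fi := fs i (mem_head _ _) Pi.
by move=> x; apply: continuousD; [exact: fi|exact: IH].
Qed.

End within_continuity.

(** * Zeros of linear forms in a Nikishin system *)

Section finite_combinations.
Local Open Scope classical_set_scope.
Local Open Scope ring_scope.
Context d (T : measurableType d) (R : realType).
Variable mu : {measure set T -> \bar R}.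

Lemma integral_lincomb (I : eqType) (s : seq I) (a : I -> R) (f : I -> T -> R) :
  (forall i, i \in s -> mu.-integrable setT (EFin \o f i)) ->
  mu.-integrable setT (fun t => (\sum_(i <- s) a i * f i t)%:E) /\
  (\int[mu]_t (\sum_(i <- s) a i * f i t)%:E =
   (\sum_(i <- s) a i * fine (\int[mu]_t (f i t)%:E))%:E)%E.
Proof.
elim: s => [|i s IH] fs.
  rewrite big_nil; split.
    by apply: eq_integrable (integrable0 _ _) => // t _; rewrite /= big_nil.
  by rewrite integral0_eq// => t _; rewrite big_nil.
have [j sj|h1 h2] := IH; first by apply: fs; rewrite inE sj orbT.
have fi : mu.-integrable setT (EFin \o f i) by apply: fs; rewrite mem_head.
have afi : mu.-integrable setT (fun t => (a i * f i t)%:E).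
  by apply: eq_integrable (integrableZl measurableT (a i) fi).
have E : (fun t => (\sum_(l <- i :: s) a l * f l t)%:E) =
    ((fun t => (a i * f i t)%:E) \+ (fun t => (\sum_(l <- s) a l * f l t)%:E))%E.
  by apply/funext => t; rewrite big_cons EFinD.
rewrite E; split; first exact: integrableD.
rewrite integralD// h2 big_cons [RHS]EFinD; congr (_ + _)%E.
under eq_integral do rewrite EFinM.
by rewrite integralZl// EFinM fineK//; exact: integrable_fin_num.
Qed.

Lemma ae_ge0_integral0 (g : T -> R) :
  mu.-integrable setT (EFin \o g) -> (\int[mu]_t (g t)%:E = 0)%E ->
  {ae mu, forall t, 0 <= g t} -> {ae mu, forall t, g t = 0}.
Proof.
move=> ig Ig g0; have mg := measurable_int _ ig.
have /ae_eq_integral_abs : (\int[mu]_t `|(EFin \o g) t| = 0)%E.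
  rewrite -Ig; apply: ae_eq_integral => //; first exact: measurableT_comp.
  by apply: filterS g0 => t g0 _; rewrite gee0_abs// lee_fin.
move=> /(_ measurableT mg); apply: filterS => t /(_ I) /= [].
by [].
Qed.

End finite_combinations.

Section orthogonality.
Local Open Scope classical_set_scope.
Local Open Scope ring_scope.
Context {R : realType}.
Local Notation T := (measurableTypeR R).

(** Here [v j] stands for a weight of the next level and [wt j] for its Cauchy transform, up to the
    sign [sg]. The function [g] is a sum over the nodes of integrable functions, so no integrability
    of the quotient by the full product has to be shown directly. *)
Lemma lagrange_orthogonality
    (lam : {finite_measure set (measurableTypeR R) -> \bar R})
    (I : eqType) (J : seq I) (p : I -> {poly R}) (q h : {poly R}) (s : seq R)
    (v wt : I -> R -> R) (sg : R) :
  uniq s -> (size (h * q)%R < size s)%N ->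
  (forall j, j \in J -> (size (h * p j)%R <= size s)%N) ->
  (forall j x, j \in J -> x \in s ->
    lam.-integrable setT (fun t : T => (v j t / (t - x))%:E) /\
    wt j x = sg * fine (\int[lam]_t (v j t / (t - x))%:E)%E) ->
  {ae lam, forall t, forall j, j \in J -> t \in s -> v j t = 0} ->
  (forall x, x \in s -> q.[x] + \sum_(j <- J) (p j).[x] * wt j x = 0) ->
  sg != 0 ->
  exists g : T -> R, [/\ lam.-integrable setT (EFin \o g),
    (\int[lam]_t (g t)%:E = 0)%E &
    {ae lam, forall t, g t = h.[t] * (\sum_(j <- J) (p j).[t] * v j t) /
      \prod_(x <- s) (t - x)}].
Proof.
move=> us hq hp Iv v0 L0 sg0.
(* For a node [x] this is the derivative at [x] of the monic polynomial with roots [s]. *)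
pose Q x := \prod_(y <- s | y != x) (x - y).
pose F x (t : T) := \sum_(j <- J) (h * p j).[x] / Q x * (v j t / (t - x)).
have IF x : x \in s -> lam.-integrable setT (EFin \o F x) /\
    fine (\int[lam]_t (F x t)%:E)%E = - (sg^-1 * (h * q).[x] / Q x).
  move=> xs.
  have [|iF ->] := @integral_lincomb _ _ _ lam _ J (fun j => (h * p j).[x] / Q x)
    (fun j (t : T) => v j t / (t - x)).
    by move=> j jJ; have [] := Iv j x jJ xs.
  split => //=.
  (* The vanishing of the form at [x] trades the sum of Cauchy transforms for [q]. *)
  have : q.[x] = - \sum_(j <- J) (p j).[x] * wt j x.
    by apply/eqP; rewrite -addr_eq0 L0.
  rewrite hornerM => ->; rewrite mulrN mulrN mulNr opprK mulr_sumr mulr_sumr mulr_suml.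
  rewrite [LHS]big_seq [RHS]big_seq; apply: eq_bigr => j jJ.
  have [_ ->] := Iv j x jJ xs.
  by rewrite hornerM; move: (Q x)^-1 => c; field.
exists (fun t => \sum_(x <- s) 1 * F x t).
have [|iG IG] := @integral_lincomb _ _ _ lam _ s (fun=> 1) F.
  by move=> x /IF[].
split => //.
  rewrite IG; congr EFin.
  transitivity (- (sg^-1 * \sum_(x <- s) (h * q).[x] / Q x)).
    rewrite mulr_sumr -sumrN [LHS]big_seq [RHS]big_seq; apply: eq_bigr => x xs.
    by have [_ ->] := IF x xs; rewrite mul1r mulrA.
  by rewrite lagrange_sum0// mulr0 oppr0.
apply: (ae_impl _ v0) => t {}v0.
rewrite /=; under eq_bigr do rewrite mul1r.
have [ts|ts] := boolP (t \in s).
  transitivity (0 : R).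
    rewrite big1// => x _; rewrite /F big_seq big1// => j jJ.
    by rewrite v0// mul0r mulr0.
  by rewrite big_seq big1 ?mulr0 ?mul0r// => j jJ; rewrite v0// mulr0.
rewrite /F exchange_big/= mulr_sumr mulr_suml.
rewrite [LHS]big_seq [RHS]big_seq; apply: eq_bigr => j jJ.
transitivity (v j t * \sum_(x <- s) (h * p j).[x] / Q x / (t - x)).
  rewrite mulr_sumr; apply: eq_bigr => x _; ring.
rewrite lagrange_sum_div// ?hp// hornerM; ring.
Qed.

End orthogonality.

Section nikishin_chain.
Local Open Scope classical_set_scope.
Local Open Scope ring_scope.
Local Open Scope ereal_scope.
Context {R : realType}.
Local Notation T := (measurableTypeR R).
Local Notation finmeas := {finite_measure set (measurableTypeR R) -> \bar R}.
Variables (r : nat) (Delta : nat -> set R) (sigma : nat -> borel_charge R).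
Hypothesis Delta_itv : forall k, (k < r)%N -> is_interval (Delta k).
Hypothesis Delta_disjoint : forall k, (k.+1 < r)%N ->
  (Delta k)° `&` (Delta k.+1)° = set0.
Hypothesis sigma_in_M : forall k, (k < r)%N -> in_M (Delta k) (sigma k).
Hypothesis sigma_defined : forall j, (j < r)%N ->
  brackets_defined [seq sigma i | i <- iota 0 j.+1].

(* <sigma_k, ..., sigma_j> *)
Definition chain k j := brackets [seq sigma i | i <- iota k (j.+1 - k)].

(* The density of <sigma_k, ..., sigma_j> with respect to sigma_k. *)
Definition weight k j : R -> \bar R :=
  if j == k then cst 1 else m_function (chain k.+1 j).

Lemma chain_diag k : chain k k = sigma k.
Proof. by rewrite /chain subSnn. Qed.

Lemma chainS k j : (k < j)%N -> chain k j = bracket (sigma k) (chain k.+1 j).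
Proof.
by move=> kj; rewrite /chain subSS (subSn (ltnW kj)) -(subnSK kj).
Qed.

Lemma chain_defined k j : (k < j)%N -> (j < r)%N ->
  bracket_defined (sigma k) (chain k.+1 j).
Proof.
move=> kj jr.
(* Definedness from index 0 passes to every tail, removing one head at a time. *)
suff H m : (m <= j)%N -> brackets_defined [seq sigma i | i <- iota m (j.+1 - m)].
  have := H k (ltnW kj).
  by rewrite /chain subSS (subSn (ltnW kj)) -(subnSK kj) => -[].
elim: m => [_|m IH mj]; first by rewrite subn0; exact: sigma_defined.
have := IH (ltnW mj).
by rewrite subSS (subSn (ltnW mj)) -(subnSK mj) => -[].
Qed.

Lemma sigma_represents k : (k < r)%N -> exists b lam, represents (sigma k) b lam.
Proof. by move=> /sigma_in_M[/constant_sign_represents]. Qed.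

Lemma sigma_ae_Delta k b lam : (k < r)%N -> represents (sigma k) b lam ->
  {ae lam, forall t, Delta k t}.
Proof.
move=> /sigma_in_M[_ _ _ sub] h.
by apply: (ae_impl _ (represents_ae_csupport h)) => t /sub.
Qed.

Lemma Delta_infinite k : (k < r)%N -> infinite_set (Delta k).
Proof. by move=> /sigma_in_M[_ _ si sub]; apply: contra_not si; exact: sub_finite_set. Qed.

Lemma Delta_le_set k : (k.+1 < r)%N ->
  le_set (Delta k) (Delta k.+1) \/ le_set (Delta k.+1) (Delta k).
Proof.
move=> kr; have kr' := ltnW kr.
by apply: le_set_total (Delta_disjoint kr); [exact: Delta_itv|exact: Delta_itv|
  exact: Delta_infinite|exact: Delta_infinite].
Qed.

(** Induction on [j - k]: the shorter chain is carried by [Delta k.+1], so its m-function has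
    constant sign on [Delta k] and the bracket with [sigma k] is again of constant sign. *)
Lemma chain_represents k j b lam : (k <= j)%N -> (j < r)%N ->
  represents (sigma k) b lam ->
  exists b' lam', [/\ represents (chain k j) b' lam', lam' `<< lam &
    forall f : T -> \bar R, lam'.-integrable setT f ->
      lam.-integrable setT (fun t => f t * weight k j t) /\
      ((-1) ^+ b')%:E * \int[lam']_t f t =
      ((-1) ^+ b)%:E * \int[lam]_t (f t * weight k j t)].
Proof.
move=> kj jr; move mE : (j - k)%N => m.
elim: m k b lam kj mE => [|m IH] k b lam kj mE h.
  have -> : j = k by apply/eqP; rewrite eqn_leq kj -subn_eq0 mE eqxx.
  exists b, lam; split; [by rewrite chain_diag|by apply/null_content_dominatesP|].
  move=> f fi; rewrite /weight eqxx.
  have -> : (fun t => f t * cst 1 t) = f by apply/funext => t; rewrite mule1.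
  by [].
have kj' : (k < j)%N by rewrite -subn_gt0 mE.
have k1r : (k.+1 < r)%N by exact: leq_ltn_trans jr.
have [b1 [lam1 h1]] := sigma_represents k1r.
have [|b' [lam' [h' ll' _]]] := IH k.+1 b1 lam1 kj' _ h1.
  by rewrite subnS mE.
have lamD' : {ae lam', forall t, Delta k.+1 t}.
  by apply: dominates_ae ll' _; exact: sigma_ae_Delta h1.
have [e we] := m_function_constant_sign h' lamD' (Delta_le_set k1r).
have d := chain_defined kj' jr.
have iw : lam.-integrable setT (m_function (chain k.+1 j) : T -> \bar R).
  by move: d => /(represents_integrable _ h).
have [|lam2 [h2 ll2 H]] := bracket_represents (e := e) h d.
  (* The sign is known only where the m-function is finite, which integrability grants almost
     everywhere. *)
  have wf : {ae lam, forall t, m_function (chain k.+1 j) t \is a fin_num}.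
    by apply: (ae_impl _ (integrable_ae measurableT iw)) => t; exact.
  apply: (ae_impl2 _ (sigma_ae_Delta (ltnW k1r) h) wf) => t Dt; exact: we.
exists (b (+) e), lam2; split => //; first by rewrite chainS.
by rewrite /weight gtn_eqF.
Qed.

Lemma weight_integrable k j b lam : (k <= j)%N -> (j < r)%N ->
  represents (sigma k) b lam -> lam.-integrable setT (weight k j : T -> \bar R).
Proof.
rewrite leq_eqVlt => /predU1P[->|kj] jr h; rewrite /weight.
  by rewrite eqxx; exact: (finite_measure_integrable_cst lam 1%R).
by rewrite gtn_eqF//; apply/(represents_integrable _ h); exact: chain_defined.
Qed.

(** A finite weight makes the kernel integrable against the chain from [k.+1]; the change of
    variables moves the integral to [sigma k.+1]. *)
Lemma weight_integral k j b lam x : (k < j)%N -> (j < r)%N ->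
  represents (sigma k.+1) b lam -> weight k j x \is a fin_num ->
  lam.-integrable setT (fun t : T => cauchy_kernel x t * weight k.+1 j t) /\
  weight k j x =
    ((-1) ^+ b)%:E * \int[lam]_t (cauchy_kernel x t * weight k.+1 j t).
Proof.
move=> kj jr h; rewrite {1 3}/weight gtn_eqF// => wf.
have [b' [lam' [h' _ H]]] := chain_represents kj jr h.
have [? <-] := H _ ((m_function_fin_numP x h').1 wf).
by split => //; exact: m_functionE.
Qed.

(** Off [Delta k.+1] the point has positive distance from the support of [sigma k.+1], so the kernel
    is bounded almost everywhere. *)
Lemma weight_fin_num k j x : (k <= j)%N -> (j < r)%N -> Delta k x ->
  ((k < j)%N -> ~ Delta k.+1 x) -> weight k j x \is a fin_num.
Proof.
rewrite leq_eqVlt => /predU1P[->|kj] jr Dx nDx; rewrite /weight ?eqxx// gtn_eqF//.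
have k1r : (k.+1 < r)%N by exact: leq_ltn_trans jr.
have [b [lam h]] := sigma_represents k1r.
have [b' [lam' [h' ll _]]] := chain_represents kj jr h.
apply/(m_function_fin_numP x h').
have [|d d0 sep] := @csupport_separated _ _ _ _ x h.
  by have [_ _ _ sub] := sigma_in_M k1r; move=> /sub; exact: nDx.
exact: integrable_cauchy_kernel_sep d0 (dominates_ae ll sep).
Qed.

(** Supplies the domination for continuity. If [x0] is a common endpoint, it lies between [x] and
    [t]; otherwise [t] keeps a distance [d] from [x0], and [x] within [d / 2] costs at most half of
    it. *)
Lemma Delta_separated k b lam x0 : (k.+1 < r)%N ->
  represents (sigma k.+1) b lam -> Delta k x0 ->
  exists2 d : R, (0 < d)%R & {ae lam, forall t, forall x, Delta k x ->
    (`|x - x0| < d)%R -> (`|t - x0| <= 2 * `|t - x|)%R}.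
Proof.
move=> k1r h Dx0.
have [D1x0|nD1x0] := pselect (Delta k.+1 x0).
  exists 1%R => //; apply: (ae_impl _ (sigma_ae_Delta k1r h)) => t Dt x Dx _.
  have : (`|t - x0| <= `|t - x|)%R.
    have [le|le] := Delta_le_set k1r.
      have := le _ _ Dx D1x0; have := le _ _ Dx0 Dt => h1 h2.
      by rewrite !ger0_norm ?subr_ge0//; lra.
    have := le _ _ D1x0 Dx; have := le _ _ Dt Dx0 => h1 h2.
    by rewrite !ler0_norm ?subr_le0//; lra.
  by have := normr_ge0 (t - x)%R; lra.
have [|d d0 sep] := @csupport_separated _ _ _ _ x0 h.
  by have [_ _ _ sub] := sigma_in_M k1r; move=> /sub.
exists (d / 2)%R; first by rewrite divr_gt0.
apply: (ae_impl _ sep) => t dt x _ xx0.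
have : (`|t - x0| <= `|t - x| + `|x - x0|)%R.
  by rewrite (le_trans _ (ler_normD _ _))// addrA subrK.
by lra.
Qed.

Lemma weight_continuous k j (D : set R) : (k <= j)%N -> (j < r)%N ->
  (forall x, D x -> Delta k x /\ weight k j x \is a fin_num) ->
  {within D, continuous (fine \o weight k j)}.
Proof.
rewrite leq_eqVlt => /predU1P[->|kj] jr HD; rewrite /weight ?eqxx ?gtn_eqF//.
  by apply: continuous_subspaceT => x; exact: cvg_cst.
have k1r : (k.+1 < r)%N by exact: leq_ltn_trans jr.
have [b [lam h]] := sigma_represents k1r.
have [b' [lam' [h' ll _]]] := chain_represents kj jr h.
apply: within_continuous_seq => x0 Dx0.
have [Dk] := HD _ Dx0; rewrite /weight gtn_eqF// => wf.
have [d d0 sep] := Delta_separated k1r h Dk.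
exists d => // u Du ux.
apply: (m_function_cvg (D := Delta k) h' _ (dominates_ae ll sep) _ ux).
  by apply/(m_function_fin_numP x0 h').
by move=> n; have [/HD[]] := Du n.
Qed.

Local Open Scope ring_scope.

Variable n : nat -> nat.
Hypothesis n_le : forall k j, (k < j)%N -> (j < r)%N -> (n j <= (n k).+1)%N.

(* The weights with n j = 0 are left out: they may be infinite on the domain. *)
Definition linear_form (p : nat -> {poly R}) k (x : R) : R :=
  \sum_(k <= j < r | (0 < n j)%N) (p j).[x] * fine (weight k j x).

Definition finite_domain k : set R :=
  [set x | Delta k x /\ forall j, (k <= j)%N -> (j < r)%N -> (0 < n j)%N ->
    weight k j x \is a fin_num].

(** A point strictly between two points of [Delta k] cannot belong to [Delta k.+1], so all weights
    are finite there. *)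
Lemma finite_domain_itv k : (k < r)%N -> is_interval (finite_domain k).
Proof.
move=> kr x y [Dx wx] [Dy wy] z /andP[xz zy].
have Dz : Delta k z by apply: (Delta_itv kr) Dx Dy _ _; rewrite xz zy.
split => // j kj jr nj.
have [<-|xz'] := eqVneq x z; first exact: wx.
have [->|zy'] := eqVneq z y; first exact: wy.
apply: weight_fin_num => // kj' Dz'.
have k1r : (k.+1 < r)%N by exact: leq_ltn_trans jr.
have [le|le] := Delta_le_set k1r.
  by have := le _ _ Dy Dz' => yz; move: zy'; rewrite eq_le zy yz.
by have := le _ _ Dz' Dx => zx; move: xz'; rewrite eq_le xz zx.
Qed.

Lemma linear_form_continuous p k : (k < r)%N ->
  {within finite_domain k, continuous (linear_form p k)}.
Proof.
move=> kr; apply: within_continuous_sum => j; rewrite mem_index_iota => /andP[kj jr] nj.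
have cw : {within finite_domain k, continuous (fine \o weight k j)}.
  by apply: weight_continuous => // x [Dx wx]; split => //; exact: wx.
have cp : {within finite_domain k, continuous (fun x => (p j).[x])}.
  by apply: continuous_subspaceT; exact: continuous_horner.
by move=> x; apply: continuousM; [exact: cp|exact: cw].
Qed.

Lemma prod_sub_sign k (s : seq R) : (k.+1 < r)%N -> (forall x, x \in s -> Delta k x) ->
  exists2 c : R, c != 0 & forall t, Delta k.+1 t -> 0 <= c * \prod_(x <- s) (t - x).
Proof.
move=> k1r sD; have [le|le] := Delta_le_set k1r.
  exists 1; first exact: oner_neq0.
  move=> t Dt; rewrite mul1r big_seq; apply: prodr_ge0 => x /sD Dx.
  by rewrite subr_ge0; exact: le.
exists ((-1) ^+ size s); first by rewrite signr_eq0.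
move=> t Dt.
have -> : (-1) ^+ size s * \prod_(x <- s) (t - x) = \prod_(x <- s) (x - t).
  elim: (s) => [|x s' IH]; first by rewrite !big_nil mul1r.
  by rewrite !big_cons -IH exprS; ring.
rewrite big_seq; apply: prodr_ge0 => x /sD Dx.
by rewrite subr_ge0; exact: le.
Qed.

Lemma weight_ae k (lam : finmeas) b : (k < r)%N -> represents (sigma k) b lam ->
  {ae lam, forall t, finite_domain k t}.
Proof.
move=> kr h.
have H m : (m <= r)%N -> {ae lam, forall t, forall j, (k <= j)%N -> (j < m)%N ->
    weight k j t \is a fin_num}.
  elim: m => [_|m IH mr]; first by apply: aeW.
  have [km|mk] := leqP k m; last first.
    apply: (ae_impl _ (IH (ltnW mr))) => t H j kj; rewrite ltnS => jm.
    by have := leq_trans kj jm; rewrite leqNgt mk.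
  apply: (ae_impl2 _ (IH (ltnW mr)) (integrable_ae measurableT (weight_integrable km mr h))).
  move=> t H1 /(_ I) H2 j kj; rewrite ltnS leq_eqVlt => /predU1P[->//|jm].
  exact: H1.
apply: (ae_impl2 _ (sigma_ae_Delta kr h) (H r (leqnn r))) => t Dt Ht.
by split => // j kj jr _; exact: Ht.
Qed.

(** Passes from extended to real integrands, so that the algebra of the orthogonality lemma
    applies. *)
Lemma weight_kernel k j b lam x : (k < j)%N -> (j < r)%N ->
  represents (sigma k.+1) b lam -> weight k j x \is a fin_num ->
  [/\ lam.-integrable setT
      (fun t : T => (fine (weight k.+1 j t) / (t - x))%:E),
    fine (weight k j x) = (-1) ^+ b *
      fine (\int[lam]_t (fine (weight k.+1 j t) / (t - x))%:E)%E &
    {ae lam, forall t, t = x -> fine (weight k.+1 j t) = 0}].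
Proof.
move=> kj jr h wf; have [iK wE] := weight_integral kj jr h wf.
have iw := weight_integrable kj jr h.
have fin2 : {ae lam, forall t, weight k.+1 j t \is a fin_num /\
    (cauchy_kernel x t * weight k.+1 j t)%E \is a fin_num}.
  apply: (ae_impl2 _ (integrable_ae measurableT iw)
    (integrable_ae measurableT iK)).
  by move=> t /(_ I) ? /(_ I).
(* At [t = x] the kernel is [+oo], so a finite product forces a zero weight; the convention
   [0 * +oo = 0] then agrees with the real quotient by 0. *)
have at0 t : weight k.+1 j t \is a fin_num ->
    (cauchy_kernel x t * weight k.+1 j t)%E \is a fin_num ->
    t = x -> weight k.+1 j t = 0%E.
  move=> w1 + tx; rewrite tx cauchy_kernelxx -tx.
  move: w1; case: (weight k.+1 j t) => // c _.
  by rewrite mulyr; case: (sgrP c) => [->|c0|c0]; rewrite ?mul1e ?mulN1e.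
have eqK : {ae lam, forall t, (fine (weight k.+1 j t) / (t - x))%:E =
    (cauchy_kernel x t * weight k.+1 j t)%E}.
  apply: (ae_impl _ fin2) => t [w1 w2].
  have [tx|tx] := eqVneq t x; first by rewrite (at0 _ w1 w2 tx) mule0 mul0r.
  by rewrite cauchy_kernelE// -[in RHS](fineK w1) -EFinM mulrC.
have mw : measurable_fun [set: T] (fun t : T => (fine (weight k.+1 j t) / (t - x))%:E).
  apply/measurable_EFinP; apply: measurable_funM.
    by apply: measurableT_comp => //; exact: measurable_int iw.
  have -> : (fun t : T => (t - x)^-1) = (fun t => if t == x then 0 else (t - x)^-1).
    by apply/funext => t; case: eqVneq => // ->; rewrite subrr invr0.
  have -> : (fun t : T => if t == x then 0 else (t - x)^-1) =
     fun t => if t == x then 0 else fine (cauchy_kernel x t).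
    by apply/funext => t; case: eqVneq => // tx; rewrite cauchy_kernelE.
  apply: measurable_fun_ifT => //.
    apply: (measurable_fun_bool true).
    rewrite setTI (_ : _ @^-1` _ = [set x]); last first.
      by apply/seteqP; split => t /=; [move/eqP|move=> ->; rewrite eqxx].
    exact: measurable_set1.
  by apply: measurableT_comp => //; exact: measurable_cauchy_kernel.
have i2 := ae_eq_integrable mw eqK iK.
split => //.
- rewrite wE signE.
  rewrite (ae_eq_integral
    (fun t : T => (fine (weight k.+1 j t) / (t - x))%:E)) //.
  + case: (b); rewrite /= ?fineN; ring.
  + exact: measurable_int iK.
  + by apply: (ae_impl _ eqK) => t ->.
- by apply: (ae_impl _ fin2) => t [w1 w2] tx; rewrite (at0 _ w1 w2 tx).
Qed.

Lemma linear_formE (p : nat -> {poly R}) k x : (k < r)%N -> (size (p k) <= n k)%N ->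
  linear_form p k x = (p k).[x] +
    \sum_(k.+1 <= j < r | (0 < n j)%N) (p j).[x] * fine (weight k j x).
Proof.
move=> kr sp; rewrite /linear_form big_ltn_cond//.
have [_|] := ltnP 0 (n k); first by rewrite /weight eqxx mulr1.
(* For [n k = 0] the form omits the term at [k], but then [p k] is zero. *)
rewrite leqn0 => /eqP nk0; move: sp; rewrite nk0 leqn0 size_poly_eq0 => /eqP ->.
by rewrite horner0 add0r.
Qed.

Lemma linear_form_zeros (p : nat -> {poly R}) k (s : seq R) : (k < r)%N ->
  (forall j, (size (p j) <= n j)%N) ->
  (exists j, [/\ (k <= j)%N, (j < r)%N & p j != 0]) ->
  uniq s -> (forall x, x \in s -> finite_domain k x /\ linear_form p k x = 0) ->
  (size s < \sum_(k <= j < r) n j)%N.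
Proof.
move=> kr sp; move mE : (r - k)%N => m.
elim: m k s kr mE => [|m IH] k s kr mE pn us Zs.
  by move: kr; rewrite -subn_gt0 mE.
rewrite ltnNge; apply/negP; rewrite big_ltn//.
set M := (\sum_(k.+1 <= j < r) n j)%N => Ns.
(* Surplus zeros are discarded, so that the number of nodes is exactly the sum of the
   multiplicities. *)
wlog sN : s us Zs Ns / size s = (n k + M)%N.
  move=> /(_ (take (n k + M)%N s)); apply.
  - exact: take_uniq.
  - by move=> x /mem_take; exact: Zs.
  - by rewrite size_takel.
  - by rewrite size_takel.
(* If only [p k] is nonzero, the form is a polynomial with fewer than [n k] roots. *)
have [[j0 [kj0 j0r pj0]]|npn] :=
    pselect (exists j, [/\ (k < j)%N, (j < r)%N & p j != 0]); last first.
  have pj0 j : (k < j)%N -> (j < r)%N -> p j = 0.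
    by move=> kj jr; apply: contrapT => /eqP pj; apply: npn; exists j.
  have pk0 : p k != 0.
    have [j [kj jr pj]] := pn; move: kj; rewrite leq_eqVlt => /predU1P[->//|kj].
    by move: pj; rewrite pj0 ?eqxx.
  have : (size s < size (p k))%N.
    apply: max_poly_roots => //; apply/allP => x /Zs[_].
    rewrite linear_formE// [X in _ + X]big_nat_cond big1 ?addr0 ?rootE => [->//|j].
    by move=> /andP[/andP[kj jr] _]; rewrite pj0// horner0 mul0r.
  by move=> /leq_trans/(_ (sp k)); rewrite sN ltnNge leq_addr.
have k1r : (k.+1 < r)%N by exact: leq_ltn_trans j0r.
have [b [lam h]] := sigma_represents k1r.
(* The induction hypothesis gives a complete list of fewer than [M] zeros of the form at the next
   level. *)
have [|zs [uz zsM zsP]] := @bounded_uniq_finite R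
    [set x | finite_domain k.+1 x /\ linear_form p k.+1 x = 0] M.
  move=> s' us' Zs'; apply: IH => //; first by rewrite subnS mE.
  by exists j0.
have szs : sorted <%R (sort <=%R zs) by rewrite sort_lt_sorted.
have [|c [S [c0 Szs hS]]] := sign_change_product (finite_domain_itv k1r)
    (@linear_form_continuous p _ k1r) szs.
  by move=> x Dx Fx; rewrite mem_sort; apply/zsP.
(* The multiplier vanishes exactly at the sign changes; fewer than [M] roots means size at most
   [M]. *)
pose h0 : {poly R} := \prod_(z <- S) ('X - z%:P).
have hM : (size h0 <= M)%N.
  rewrite size_prod_XsubC; apply: leq_trans zsM.
  by rewrite ltnS (leq_trans (size_subseq Szs))// size_sort.
have M0 : (0 < M)%N by exact: leq_trans zsM.
pose J := [seq j <- index_iota k.+1 r | (0 < n j)%N].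
have JP j : j \in J -> [/\ (k < j)%N, (j < r)%N & (0 < n j)%N].
  by rewrite mem_filter mem_index_iota => /and3P[].
have Zf x j : x \in s -> j \in J -> weight k j x \is a fin_num.
  by move=> /Zs[[_ wx] _] /JP[kj jr nj]; apply: wx => //; exact: ltnW.
(* The product loses one in size: this makes the bound strict for [p k], and for the other [p j] it
   absorbs the extra 1 in [n j <= (n k).+1]. *)
have sizeh (q : {poly R}) t : (size q <= t)%N -> (size (h0 * q)%R <= (M + t).-1)%N.
  move=> qt; apply: (leq_trans (size_polyMleq _ _)).
  by rewrite -!subn1 leq_sub2r// leq_add.
have [|j Jj|j x Jj sx||x sx||g [ig Ig gE]] := @lagrange_orthogonality R lam _ J p (p k) h0
    s (fun j t => fine (weight k.+1 j t)) (fun j x => fine (weight k j x))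
    ((-1) ^+ b) us.
- by apply: (leq_ltn_trans (sizeh _ _ (sp k))); rewrite sN addnC prednK ?addn_gt0 ?M0 ?orbT.
- have [kj jr _] := JP _ Jj.
  apply: (leq_trans (sizeh _ _ (leq_trans (sp j) (n_le kj jr)))).
  by rewrite sN addnS/= addnC.
- have [kj jr _] := JP _ Jj.
  by have [] := weight_kernel kj jr h (Zf x j sx Jj).
- have : {ae lam, forall t, forall x, x \in s -> forall j, j \in J ->
      t = x -> fine (weight k.+1 j t) = 0}.
    apply: (ae_seq (P := fun x t => forall j, j \in J -> t = x ->
      fine (weight k.+1 j t) = 0)) => x sx.
    apply: (ae_seq (P := fun j t => t = x -> fine (weight k.+1 j t) = 0)) => j Jj.
    have [kj jr _] := JP _ Jj.
    by have [] := weight_kernel kj jr h (Zf x j sx Jj).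
  by move=> H; apply: (ae_impl _ H) => t {}H j Jj ts; exact: (H t).
- have [_] := Zs _ sx; rewrite linear_formE// => Lx0; rewrite -[RHS]Lx0.
  by rewrite /J big_filter.
- by rewrite signr_eq0.
have {}gE : {ae lam, forall t, g t = h0.[t] * linear_form p k.+1 t / \prod_(x <- s) (t - x)}.
  by apply: (ae_impl _ gE) => t ->; rewrite /J big_filter.
have [|c' c'0 hQ] := @prod_sub_sign k s k1r; first by move=> x /Zs[[]].
have lD := weight_ae k1r h.
have igc : lam.-integrable setT (EFin \o (fun t : T => c * c' * g t)).
  by apply: eq_integrable (integrableZl measurableT (c * c') ig).
have g0 : {ae lam, forall t, c * c' * g t = 0}.
  apply: ae_ge0_integral0 => //.
    by rewrite (_ : (fun t : T => _) = fun t => ((c * c')%:E * (g t)%:E)%E)// integralZl// Ig mule0.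
  apply: (ae_impl2 _ lD gE) => t Dt ->.
  (* The sign is controlled off the zeros; at a zero the whole product is 0. *)
  have [tz|tz] := boolP (t \in sort <=%R zs).
    by move: tz; rewrite mem_sort => /zsP[_ ->]; rewrite mulr0 mul0r mulr0.
  have := hS t Dt tz; have := hQ t Dt.1.
  set Q := \prod_(x <- s) _ => Q0 F0.
  have -> : c * c' * (h0.[t] * linear_form p k.+1 t / Q) =
      c * \prod_(s <- S) (t - s) * linear_form p k.+1 t * (c' / Q).
    by rewrite /h0 horner_prod_XsubC; ring.
  apply: mulr_ge0 => //.
  (* At a node the quotient by [Q = 0] is 0 by convention. *)
  have [->|Qn0] := eqVneq Q 0; first by rewrite invr0 mulr0.
  have -> : c' / Q = c' * Q / Q ^+ 2 by field.
  by rewrite divr_ge0// exprn_even_ge0.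
(* Since [g] vanishes almost everywhere, almost every [t] is a zero of the form, a root of [h0] or a
   node, so [sigma k.+1] would have finite support. *)
have [_ _ + _] := sigma_in_M k1r; apply.
apply: (@ae_finite_csupport _ _ _ _ (zs ++ S ++ s) h).
have gE0 := ae_impl2 (fun t (u : g t = _) (w : c * c' * g t = 0) => conj u w) gE g0.
apply: (ae_impl2 _ lD gE0) => t Dt [gtE /eqP].
rewrite gtE mulf_eq0 mulf_eq0 (negbTE c0) (negbTE c'0)/= !mulf_eq0 invr_eq0.
rewrite !mem_cat => /orP[/orP[|/eqP Ft]|].
- by rewrite -/(root _ _) /h0 root_prod_XsubC => ->; rewrite orbT.
- by apply/orP; left; apply/zsP.
- rewrite prodf_seq_eq0 => /hasP[x xs /=]; rewrite subr_eq0 => /eqP ->.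
  by rewrite xs !orbT.
Qed.

End nikishin_chain.

(** * From the zero count to the AT property *)

Section nikishin_system_AT.
Local Open Scope classical_set_scope.
Local Open Scope ring_scope.
Context {R : realType}.

Lemma map_segment (U : Type) (r : nat) (f : 'I_r -> U) (g : nat -> U) (i j : nat) :
  (forall k : 'I_r, g k = f k) -> (j < r)%N ->
  segment f i j = [seq g k | k <- iota i (j.+1 - i)].
Proof.
move=> gf jr; rewrite /segment.
have -> s : map f s = map g (map val s).
  by rewrite -map_comp; apply: eq_map => k /=; rewrite gf.
congr map; rewrite -(filter_map val (fun k => i <= k <= j)%N) val_enum_ord.
apply: (irr_sorted_eq ltn_trans ltnn).
- exact: (sorted_filter ltn_trans _ (iota_ltn_sorted 0 r)).
- exact: iota_ltn_sorted.
move=> k; rewrite mem_filter !mem_iota; apply/idP/idP; lia.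
Qed.

(* The row v lists the coefficients of all the polynomials p_j one after the
   other, in the order of AT_functions. *)
Definition AT_polynomial (r : nat) (n : 'I_r -> nat)
    (v : 'rV[R]_(\sum_j n j)%N) (j : 'I_r) : {poly R} :=
  \sum_(i | tagnat.sig1 i == j) v 0 i *: 'X^(tagnat.sig2 i).

Lemma AT_polynomialP (r : nat) (n : 'I_r -> nat) (w : 'I_r -> R -> \bar R)
    (v : 'rV[R]_(\sum_j n j)%N) (p := AT_polynomial v) :
  [/\ forall j, (size (p j) <= n j)%N,
      v != 0 -> exists j, p j != 0 &
      forall x, \sum_j (p j).[x] * fine (w j x) =
        \sum_i v 0 i * AT_functions w (n := n) i x].
Proof.
split.
- move=> j; apply: (leq_trans (size_sum _ _ _)); apply/bigmax_leqP => i /eqP <-.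
  by rewrite (leq_trans (size_scale_leq _ _))// size_polyXn.
- move=> /rV0Pn[i0 vi0]; exists (tagnat.sig1 i0).
  suff E : (p (tagnat.sig1 i0))`_(tagnat.sig2 i0) = v 0 i0.
    by apply: contraNneq vi0 => p0; rewrite -E p0 coef0.
  rewrite coef_sum (bigD1 i0) //= [X in _ + X]big1 => [|i /andP[/eqP i1 ii0]].
    by rewrite addr0 coefZ coefXn eqxx mulr1.
  rewrite coefZ coefXn; case: eqP => [e|_]; last by rewrite mulr0.
  (* Two positions with the same block and the same exponent coincide, so no other term reaches this
     coefficient. *)
  have : tagnat.Rank _ (tagnat.sig2 i) == tagnat.Rank _ (tagnat.sig2 i0) :> nat.
    by rewrite tagnat.eq_Rank; apply/andP; split; apply/eqP.
  by rewrite !tagnat.sig2K val_eqE (negbTE ii0).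
- move=> x; rewrite [RHS](partition_big (@tagnat.sig1 _ _) predT)//=.
  apply: eq_bigr => j _; rewrite horner_sum mulr_suml.
  apply: eq_bigr => i /eqP <-.
  by rewrite hornerZ hornerXn mulrA.
Qed.

Variables (r : nat) (hr : (0 < r)%N) (Delta : 'I_r -> set R).
Variables (sigma mu : 'I_r -> borel_charge R) (n : 'I_r -> nat).
Hypothesis ns : nikishin_system Delta sigma mu.
Hypothesis n_ge : forall j : 'I_r, (j.+1 < r)%N ->
  ((\max_(i < r | (j < i)%N) n i) - 1 <= n j)%N.

(** Families over ['I_r] are extended to all naturals, which makes successor indices available; an
    index beyond the range falls back to the first one. *)
Let idx (k : nat) : 'I_r := insubd (Ordinal hr) k.
Let D k := Delta (idx k).
Let S k := sigma (idx k).
Let N k := n (idx k).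
Let o := Ordinal hr.

Let val_idx k : (k < r)%N -> idx k = k :> nat.
Proof. by move=> kr; rewrite /idx val_insubd kr. Qed.

Let idxK (j : 'I_r) : idx j = j.
Proof. exact: valKd. Qed.

Let D_itv k : (k < r)%N -> is_interval (D k).
Proof. by move=> _; exact: nikishin_itv ns _. Qed.

Let D_disjoint k : (k.+1 < r)%N -> (D k)° `&` (D k.+1)° = set0.
Proof. by move=> kr; apply: (nikishin_disjoint ns); rewrite !val_idx// ltnW. Qed.

Let S_in_M k : (k < r)%N -> in_M (D k) (S k).
Proof. by move=> _; exact: nikishin_generator ns _. Qed.

Let segmentE i j : (j < r)%N -> segment sigma i j = [seq S k | k <- iota i (j.+1 - i)].
Proof. by move=> jr; apply: map_segment => // k; rewrite /S idxK. Qed.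

Let S_defined j : (j < r)%N -> brackets_defined [seq S i | i <- iota 0 j.+1].
Proof.
move=> jr; have := nikishin_finite ns (Ordinal jr).
by rewrite segmentE// subn0.
Qed.

(** A truncated difference [max - 1] is at most [n k] exactly when the maximum, and so each later
    multiplicity, is at most [n k + 1]. *)
Let N_le k j : (k < j)%N -> (j < r)%N -> (N j <= (N k).+1)%N.
Proof.
move=> kj jr; have kr := ltn_trans kj jr.
have : (n (idx j) <= \max_(i < r | (idx k < i)%N) n i)%N.
  apply: (@leq_bigmax_cond _ (fun i : 'I_r => (idx k < i)%N) n (idx j)).
  by rewrite !val_idx.
rewrite /N -[(n (idx k)).+1]add1n -leq_subLR => /(leq_sub2r 1)/leq_trans; apply.
by apply: n_ge; rewrite val_idx//; exact: leq_ltn_trans jr.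
Qed.

Lemma nikishin_weightE (j : 'I_r) : nikishin_weight sigma j = weight S 0 j.
Proof. by rewrite /nikishin_weight /weight /chain; case: ifP => // _; rewrite segmentE. Qed.

Lemma nikishin_measureE (j : 'I_r) A : measurable A -> mu j A = chain S 0 j A.
Proof. by move=> mA; rewrite (nikishinE ns)// segmentE. Qed.

Let AT_domainP x : AT_domain (Delta o) (nikishin_weight sigma) n x ->
  finite_domain r D S N 0 x.
Proof.
move=> [Dx wx]; split; first by rewrite /D -/o (_ : idx 0 = o)//; exact: (idxK o).
move=> j _ jr nj; have := wx (idx j) nj.
by rewrite nikishin_weightE val_idx.
Qed.

(** A zero determinant gives a nonzero row in the left kernel, that is, coefficients of a nontrivial
    linear form vanishing at as many distinct points as there are functions; the zero count forbids
    this. *)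
Lemma nikishin_chebyshev :
  chebyshev_system (AT_functions (nikishin_weight sigma) (n := n))
    (AT_domain (Delta o) (nikishin_weight sigma) n).
Proof.
split=> [i|x xinj Dx].
  set j := tagnat.sig1 i; have nj : (0 < n j)%N by exact: leq_ltn_trans (ltn_ord (tagnat.sig2 i)).
  have cw : {within AT_domain (Delta o) (nikishin_weight sigma) n,
      continuous (fine \o weight S 0 j)}.
    apply: (weight_continuous D_itv D_disjoint S_in_M S_defined) => // x Dx.
    have [Dx0 wx] := AT_domainP Dx; split => //.
    by apply: wx => //; rewrite /N idxK.
  have cX : {within AT_domain (Delta o) (nikishin_weight sigma) n,
      continuous (fun x : R => x ^+ tagnat.sig2 i)}.
    by apply: continuous_subspaceT; exact: exprn_continuous.
  have -> : AT_functions (nikishin_weight sigma) (n := n) i =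
      fun x => x ^+ tagnat.sig2 i * (fine \o weight S 0 j) x.
    by apply/funext => x; rewrite /AT_functions nikishin_weightE.
  exact: within_continuousM cX cw.
apply/negP => /det0P[v v0 vA].
have [ps pn pE] := AT_polynomialP (nikishin_weight sigma) v.
set p := AT_polynomial v in ps pn pE.
have [j pj] := pn v0.
have us : uniq [seq x i | i <- enum 'I_(\sum_j n j)%N].
  by rewrite map_inj_uniq ?enum_uniq.
have : (size [seq x i | i <- enum 'I_(\sum_j n j)%N] < \sum_(0 <= j < r) N j)%N.
  apply: (linear_form_zeros D_itv D_disjoint S_in_M S_defined N_le hr
    (p := fun k => p (idx k))) => //.
    by exists j; rewrite idxK.
  move=> y /mapP[i _ ->]; split; first by apply: AT_domainP; exact: Dx.
  have {}vA : \sum_l v 0 l * AT_functions (nikishin_weight sigma) (n := n) l (x i) = 0.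
    have := congr1 (fun M : 'rV[R]__ => M 0 i) vA; rewrite !mxE => vA0.
    by rewrite -[RHS]vA0; apply: eq_bigr => l _; rewrite mxE.
  rewrite -[RHS]vA -pE /linear_form big_mkord.
  (* The terms omitted from the linear form have [n k = 0], hence a zero polynomial. *)
  rewrite [RHS](bigID (fun j => 0 < n j)%N)/= [X in _ = _ + X]big1 ?addr0.
    by apply: eq_big => k; rewrite ?/N ?idxK// nikishin_weightE.
  move=> k; rewrite -leqNgt leqn0 => /eqP nk0.
  have := ps k; rewrite nk0 leqn0 size_poly_eq0 => /eqP ->.
  by rewrite horner0 mul0r.
rewrite size_map size_enum_ord big_mkord.
by under [X in (_ < X)%N]eq_bigr do rewrite /N idxK; rewrite ltnn.
Qed.

Lemma nikishin_integrable (j : 'I_r) :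
  cintegrable (sigma o) (nikishin_weight sigma j) /\
  (forall A : set R, measurable A ->
    mu j A = cintegral (sigma o) A (nikishin_weight sigma j)).
Proof.
have So : S 0 = sigma o by rewrite /S (idxK o).
have [b [lam h]] := sigma_represents S_in_M hr.
have iw := weight_integrable S_defined (leq0n j) (ltn_ord j) h.
rewrite -So nikishin_weightE; split; first exact/(represents_integrable _ h).
move=> A mA; rewrite nikishin_measureE// (represents_integral _ h mA).
have [j0|j0] := posnP j.
  rewrite /weight j0 eqxx chain_diag h//.
  by rewrite integral_cst// mul1e.
rewrite /weight gtn_eqF// chainS// (bracketE h _ mA)//.
exact: (chain_defined S_defined).
Qed.

(** Only the support needs care: [mu j] is dominated by the measure of the first generator, so an
    open set null for that generator is null for [mu j]. *)
Lemma nikishin_in_M_Delta (j : 'I_r) : in_M (Delta o) (mu j).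
Proof.
have [sg mom inf _] := nikishin_in_M ns j; split => //.
have [b [lam h]] := sigma_represents S_in_M hr.
have [b' [lam' [h' ll _]]] :=
  chain_represents D_itv D_disjoint S_in_M S_defined (leq0n j) (ltn_ord j) h.
have hmu : represents (mu j) b' lam'.
  by move=> A mA; rewrite nikishin_measureE//; exact: h'.
have [_ _ _ sub] := S_in_M hr.
move=> x xs; suff : D 0 x by rewrite /D (idxK o).
apply: sub; move: xs.
rewrite (represents_csupport hmu) (represents_csupport h) => H U oU Ux.
apply: contra (H U oU Ux) => /eqP U0.
by apply/eqP; move/null_content_dominatesP : ll; apply => //; exact: open_measurable.
Qed.

Lemma AT_domain_off_common x : Delta o x ->
  (forall j : 'I_r, j = 1%N :> nat -> ~ Delta j x) ->
  AT_domain (Delta o) (nikishin_weight sigma) n x.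
Proof.
move=> Dx nDx; split => // j _; rewrite nikishin_weightE.
apply: (weight_fin_num D_itv D_disjoint S_in_M S_defined) => //.
  by rewrite /D (idxK o).
move=> j0; apply: nDx; rewrite val_idx//; exact: leq_ltn_trans (ltn_ord j).
Qed.

End nikishin_system_AT.

(* Second conjunct: the Chebyshev system lives on the whole of Delta_1, up to
   an endpoint shared with Delta_2 at which the weights diverge. *)
Theorem theorem5 (R : realType) (r : nat) (hr : (0 < r)%N)
    (Delta : 'I_r -> set R) (sigma mu : 'I_r -> borel_charge R)
    (n : 'I_r -> nat) :
  nikishin_system Delta sigma mu ->
  (forall j : 'I_r, (j.+1 < r)%N ->
     ((\max_(i < r | (j < i)%N) n i) - 1 <= n j)%N) ->
  AT_system (Delta (Ordinal hr)) (sigma (Ordinal hr))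
    (nikishin_weight sigma) mu n /\
  (forall x : R, Delta (Ordinal hr) x ->
     (forall j : 'I_r, j = 1%N :> nat -> ~ Delta j x) ->
     AT_domain (Delta (Ordinal hr)) (nikishin_weight sigma) n x).
Proof.
move=> ns n_ge; split; last by move=> x; exact: (AT_domain_off_common n ns).
split.
- exact: nikishin_generator ns _.
- exact: (nikishin_in_M_Delta hr ns).
- exact: (nikishin_integrable hr ns).
- exact: (nikishin_chebyshev hr ns n_ge).
Qed.
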